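(* Let $n\ge 2$, let $u\in S^{n-1}$, and let $H=u^\perp$ be oriented with $u\in H^+$. Suppose that $\mathcal{E}=\mathcal{K}^n_n$ or $\mathcal{E}=\mathcal{K}^n$, and that $\diamondsuit:\mathcal{E}\to\mathcal{L}^n$ is monotonic, measure preserving, respects $H$-cylinders, and maps balls to balls. Let $\varphi_\diamondsuit:\mathbb{R}\to\mathbb{R}$ be the contraction satisfying $\diamondsuit B(x+tu,r)=B(x+\varphi_\diamondsuit(t)u,r)$, essentially, for all $r>0$, $x\in H$, and $t\in\mathbb{R}$. Then $\varphi_\diamondsuit(t)=t$ (for all $t\in\mathbb{R}$), $\varphi_\diamondsuit(t)=-t$, $\varphi_\diamondsuit(t)=|t|$, or $\varphi_\diamondsuit(t)=-|t|$, if and only if $\diamondsuit$ essentially equals $\mathrm{Id}$, $\dagger$, $\diamondsuit_{P_H}$, or $\diamondsuit_{P_H}^\dagger$, respectively.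
   Context: $\mathcal{H}^n$ is $n$-dimensional Hausdorff (Lebesgue) measure on $\mathbb{R}^n$; ''essentially'' means up to a set of $\mathcal{H}^n$-measure zero; two set maps are essentially equal if for each set in their domain the two images agree up to a set of $\mathcal{H}^n$-measure zero. $\mathcal{L}^n$ is the class of $\mathcal{H}^n$-measurable sets of finite $\mathcal{H}^n$-measure in $\mathbb{R}^n$; $\mathcal{K}^n$ is the class of nonempty compact convex sets; $\mathcal{K}^n_n$ is the class of convex bodies (members of $\mathcal{K}^n$ with interior points). $S^{n-1}$ is the unit sphere, $u^\perp$ is the hyperplane through the origin orthogonal to $u$, $H^\perp$ is the line spanned by $u$. $B(x,r)$ is the closed ball with center $x$ and radius $r$; ''ball'' means closed $n$-dimensional ball (positive radius). A contraction is a Lipschitz function with Lipschitz constant $1$. $H^+$ is the closed half-space bounded by $H$ containing $u$, and $H^-$ is the other closed half-space. $x^\dagger$ and $A^\dagger$ denote the reflections in $H$ of a point $x$ and a set $A$; $\dagger$ as a set map is $A\mapsto A^\dagger$. The polarization $\diamondsuit_{P_H}A$ of a set $A$ is the set with: for $x\in H^+$, $x\in\diamondsuit_{P_H}A$ iff $\{x,x^\dagger\}\cap A\ne\emptyset$; for $x\in H^-$, $x\in\diamondsuit_{P_H}A$ iff $\{x,x^\dagger\}\subset A$. The map $\diamondsuit_{P_H}^\dagger$ is $A\mapsto(\diamondsuit_{P_H}A)^\dagger$. Properties of $\diamondsuit:\mathcal{E}\subset\mathcal{L}^n\to\mathcal{L}^n$, required for all $K,L\in\mathcal{E}$, with sets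 of $\mathcal{H}^n$-measure zero ignored in all inclusions and equalities of sets: - monotonic: $K\subset L\Rightarrow\diamondsuit K\subset\diamondsuit L$; - measure preserving: $\mathcal{H}^n(\diamondsuit K)=\mathcal{H}^n(K)$; - respects $H$-cylinders: if $K\subset(B(x,r)\cap H)+H^\perp$, then $\diamondsuit K\subset(B(x,r)\cap H)+H^\perp$ (for all $x\in\mathbb{R}^n$, $r>0$); - maps balls to balls: if $K=B(x,r)$, then $\diamondsuit K=B(x',r')$ for some $x'$ and $r'$. Under the hypotheses on $\diamondsuit$, the contraction $\varphi_\diamondsuit$ exists and is unique. *)

(* Defs.v *)
From mathcomp Require Import all_boot all_order all_algebra.
From mathcomp Require Import all_classical all_reals all_analysis.
Set Implicit Arguments.
Unset Strict Implicit.
Unset Printing Implicit Defensive.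
Import Order.TTheory GRing.Theory Num.Theory.
Import numFieldNormedType.Exports.
Local Open Scope classical_set_scope.
Local Open Scope ring_scope.

(* R^n is 'rV[R]_n. The library norm on 'rV[R]_n is the sup norm, hence the
   Euclidean structure below; its topology (used by compact and interior) is
   the usual one. *)
Definition dotp (R : realType) (n : nat) (x y : 'rV[R]_n) : R :=
  \sum_(i < n) x ord0 i * y ord0 i.

Definition enorm (R : realType) (n : nat) (x : 'rV[R]_n) : R :=
  Num.sqrt (dotp x x).

Definition cball (R : realType) (n : nat) (x : 'rV[R]_n) (r : R) :
    set 'rV[R]_n :=
  [set y | enorm (y - x) <= r].

Definition box (R : realType) (n : nat) (a b : 'rV[R]_n) : set 'rV[R]_n :=
  [set x | forall i, a ord0 i < x ord0 i <= b ord0 i].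

Definition box_volume (R : realType) (n : nat) (a b : 'rV[R]_n) : R :=
  \prod_(i < n) (b ord0 i - a ord0 i).

Definition box_cover (R : realType) (n : nat) (A : set 'rV[R]_n)
    (a b : nat -> 'rV[R]_n) : Prop :=
  (forall k i, a k ord0 i <= b k ord0 i) /\
  A `<=` \bigcup_k box (a k) (b k).

(* n-dimensional Lebesgue outer measure, i.e. Hausdorff measure H^n on R^n
   with its usual normalization. It is defined on all subsets, and is Lebesgue
   measure on the Caratheodory-measurable ones. *)
Definition Hn (R : realType) (n : nat) (A : set 'rV[R]_n) : \bar R :=
  ereal_inf [set s | exists a b, box_cover A a b /\
    s = (\sum_(k <oo) (box_volume (a k) (b k))%:E)%E].

Definition ess_subset (R : realType) (n : nat) (A B : set 'rV[R]_n) : Prop :=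
  Hn (A `\` B) = 0%E.

Definition ess_eq (R : realType) (n : nat) (A B : set 'rV[R]_n) : Prop :=
  Hn ((A `\` B) `|` (B `\` A)) = 0%E.

Definition ess_eq_map (R : realType) (n : nat) (E : set (set 'rV[R]_n))
    (F G : set 'rV[R]_n -> set 'rV[R]_n) : Prop :=
  forall K, E K -> ess_eq (F K) (G K).

Definition finite_measurable (R : realType) (n : nat) : set (set 'rV[R]_n) :=
  [set A | caratheodory_measurable (@Hn R n) A /\ (Hn A < +oo)%E].

Definition compact_convex (R : realType) (n : nat) : set (set 'rV[R]_n) :=
  [set K : set 'rV[R]_n | [/\ K !=set0, compact K & convex_set K]].

Definition convex_bodies (R : realType) (n : nat) : set (set 'rV[R]_n) :=
  [set K | compact_convex K /\ interior K !=set0].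

Definition hyperplane (R : realType) (n : nat) (u : 'rV[R]_n) :
    set 'rV[R]_n :=
  [set x | dotp x u = 0].

Definition halfspace_pos (R : realType) (n : nat) (u : 'rV[R]_n) :
    set 'rV[R]_n :=
  [set x | 0 <= dotp x u].

Definition halfspace_neg (R : realType) (n : nat) (u : 'rV[R]_n) :
    set 'rV[R]_n :=
  [set x | dotp x u <= 0].

(* The reflection in hyperplane u, for a unit vector u. *)
Definition reflection (R : realType) (n : nat) (u x : 'rV[R]_n) : 'rV[R]_n :=
  x - (2 * dotp x u) *: u.

Definition reflection_set (R : realType) (n : nat) (u : 'rV[R]_n)
    (A : set 'rV[R]_n) : set 'rV[R]_n :=
  reflection u @` A.

(* The two clauses agree on hyperplane u, where reflection u x = x. *)
Definition polarization (R : realType) (n : nat) (u : 'rV[R]_n)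
    (A : set 'rV[R]_n) : set 'rV[R]_n :=
  [set x | (halfspace_pos u x /\ [set x; reflection u x] `&` A !=set0) \/
           (halfspace_neg u x /\ [set x; reflection u x] `<=` A)].

(* (B(x, r) `&` H) + H^perp with H = hyperplane u; x need not lie on H. *)
Definition cylinder (R : realType) (n : nat) (u x : 'rV[R]_n) (r : R) :
    set 'rV[R]_n :=
  [set y + t *: u | y in cball x r `&` hyperplane u & t in [set: R]].

(* Set maps on E are total functions, constrained only on members of E. *)
Section set_map_properties.
Variables (R : realType) (n : nat) (E : set (set 'rV[R]_n)).
Variable D : set 'rV[R]_n -> set 'rV[R]_n.

Definition monotonic : Prop :=
  forall K L, E K -> E L -> ess_subset K L -> ess_subset (D K) (D L).

Definition measure_preserving : Prop :=
  forall K, E K -> Hn (D K) = Hn K.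

Definition respects_cylinders (u : 'rV[R]_n) : Prop :=
  forall K x r, E K -> 0 < r ->
    ess_subset K (cylinder u x r) -> ess_subset (D K) (cylinder u x r).

Definition maps_balls_to_balls : Prop :=
  forall K x r, E K -> 0 < r -> ess_eq K (cball x r) ->
    exists x' r', 0 < r' /\ ess_eq (D K) (cball x' r').

End set_map_properties.

(* Main.v *)
From HB Require Import structures.
Require Import Defs.
From mathcomp Require Import all_boot all_order all_algebra.
From mathcomp Require Import all_classical all_reals all_analysis.
From mathcomp Require Import measurable_realfun ring lra.
Import Order.TTheory GRing.Theory Num.Theory.
Import numFieldNormedType.Exports.
Local Open Scope classical_set_scope.
Local Open Scope ring_scope.

Set Implicit Arguments.
Unset Strict Implicit.
Unset Printing Implicit Defensive.

(** Write O for the interior of a body K. Each ball inside O is sent by the map D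
    to the ball with the same radius whose centre has its height t over the
    hyperplane replaced by phi t. By monotonicity D K contains all these image
    balls, hence, up to a null set, the set they sweep out: O itself when phi t = t,
    and the upper half of the polarization of O when phi t = |t|. As soon as a set G
    with Hn G = Hn K is known to lie in D K, the inclusion is an essential equality,
    because D preserves measure ([image_ess_eq]). For G = O this needs the boundary
    of a compact convex set to be null ([Hn_boundary_null]): a solid body shrunk
    slightly towards an interior point fits into its own interior, and a flat one has
    infinitely many disjoint translates in a bounded region.

    For the polarization of O, balls do not reach the points x below the hyperplane
    for which x and its mirror image x' both lie in O. There the hypothesis on cylinders
    enters. A thin drum, the intersection of a ball centred on the hyperplane
    with a narrow coaxial cylinder, contains x and x' and lies in K
    by convexity. As phi 0 = 0, D fixes the ball; as it respects the cylinder, the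
    image of the drum is essentially inside the drum, and having the same measure it
    is the drum ([drum_ess_subset_image]). So D K contains a neighbourhood of x.
    That polarizing preserves measure ([Hn_polarization]) rests on
    the invariance of Hn under reflections ([Hn_reflection]). This last fact follows
    from invariance under translations and homotheties: the image
    measure is a constant multiple of Hn on cubes, and the constant is at most 1
    because the reflection maps the unit ball to itself.

    The cases phi t = - t and phi t = - |t| are the previous two for the map
    K |-> (D K) reflected. Conversely phi is read off from the image of the unit
    balls with centres t u, because two balls of radius 1 that agree up to a null set
    have the same centre. *)

(** * Lebesgue outer measure *)

Section outer_measure.
Context {R : realType} {n : nat}.
Implicit Types A B : set 'rV[R]_n.

Lemma box_volume_ge0 (a b : 'rV[R]_n) :
  (forall i, a ord0 i <= b ord0 i) -> 0 <= box_volume a b.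
Proof. by move=> ab; apply: prodr_ge0 => i _; rewrite subr_ge0. Qed.

Lemma Hn_ge0 A : (0 <= Hn A)%E.
Proof.
apply: le_ereal_inf_tmp => _ [a [b [[ab _] ->]]].
by apply: nneseries_ge0 => k _ _; rewrite lee_fin box_volume_ge0.
Qed.

Lemma le_Hn : {homo @Hn R n : A B / A `<=` B >-> (A <= B)%E}.
Proof.
move=> A B AB; apply: ereal_inf_le_tmp => _ [a [b [[ab Bsub] ->]]].
by exists a, b; split => //; split => //; apply: subset_trans Bsub.
Qed.

Lemma Hn_le_cover A (a b : nat -> 'rV[R]_n) : box_cover A a b ->
  (Hn A <= \sum_(k <oo) (box_volume (a k) (b k))%:E)%E.
Proof. by move=> cov; apply: ereal_inf_lbound; exists a, b. Qed.

Lemma exists_cover_le A (e : R) : (Hn A < +oo)%E -> 0 < e ->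
  exists c : nat -> 'rV[R]_n * 'rV[R]_n,
    box_cover A (fst \o c) (snd \o c) /\
    (\sum_(k <oo) (box_volume (c k).1 (c k).2)%:E <= Hn A + e%:E)%E.
Proof.
move=> Afin e0; have Anum : Hn A \is a fin_num by rewrite ge0_fin_numE ?Hn_ge0.
have [_ [a [b [cov ->]]] lt] := lb_ereal_inf_adherent e0 Anum.
by exists (fun k => (a k, b k)); split=> //; exact/ltW.
Qed.

(** Merge covers of the [A i] that are optimal up to e / 2^(i+1), enumerating the
    pairs (set, box of its cover) by a bijection with nat. *)
Lemma Hn_sigma_subadditive : sigma_subadditive (@Hn R n).
Proof.
move=> A; have [Afin|] := pselect (forall i, Hn (A i) < +oo)%E; last first.
  move=> /existsNP[i /negP]; rewrite -leNgt leye_eq => /eqP Ai.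
  rewrite (eseries_pinfty _ _ Ai) ?leey// => k _.
  by rewrite -ltNye (lt_le_trans _ (Hn_ge0 _)).
apply/lee_addgt0Pr => e e0.
apply: le_trans (epsilon_trick _ (fun k => Hn_ge0 _) (ltW e0)).
have [G PG] := choice (fun k => exists_cover_le (Afin k)
  (divr_gt0 e0 (ltr0Sn R (2 ^ k.+1).-1))).
pose v i j := (box_volume (G i j).1 (G i j).2)%:E.
have v_ge0 i j : (0 <= v i j)%E by rewrite lee_fin; apply: box_volume_ge0 => l; apply: (PG i).1.1.
have /card_esym/ppcard_eqP[f] := card_nat2.
apply: (@le_trans _ _ (\sum_(k <oo) v (f k).1 (f k).2)%E).
  apply: (@Hn_le_cover _ (fun k => (G (f k).1 (f k).2).1)
    (fun k => (G (f k).1 (f k).2).2)); split=> [k i|x [k _ Akx]].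
    exact: (PG (f k).1).1.1.
  have [j _ xj] := (PG k).1.2 _ Akx.
  by exists (f^-1%FUN (k, j)) => //=; rewrite invK ?inE.
have -> : (\sum_(k <oo) v (f k).1 (f k).2 = \sum_(i <oo) \sum_(j <oo) v i j)%E.
  rewrite nneseries_esumT// nneseries_esumT; last first.
    by move=> i; apply: nneseries_ge0.
  under [RHS]eq_esum do rewrite nneseries_esumT//.
  rewrite esum_esum// (_ : _ `*`` _ = setT) ?(reindex_esum setT _ f)//.
  by apply/seteqP.
apply: lee_nneseries => [k _ _|k _]; first exact: nneseries_ge0.
by have := (PG k).2; rewrite prednK// expn_gt0.
Qed.

End outer_measure.

(** * Homotheties, Borel sets and locally null sets *)

Section lebesgue_outer_measure.
Context {R : realType} {n : nat}.
Local Notation V := 'rV[R]_n.+1.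
Implicit Types (a b x v : V) (A B : set V).

Lemma Hn_box_le a b : (forall i, a ord0 i <= b ord0 i) ->
  (Hn (box a b) <= (box_volume a b)%:E)%E.
Proof.
move=> ab; pose c k : V := if k is 0%N then a else 0.
pose d k : V := if k is 0%N then b else 0.
have cd k i : c k ord0 i <= d k ord0 i by case: k => [|k] /=.
have /(@Hn_le_cover R n.+1)/le_trans : box_cover (box a b) c d.
  by split=> // x abx; exists 0%N.
apply; rewrite (nneseries_split _ 1); last first.
  by move=> k _; rewrite lee_fin box_volume_ge0.
rewrite /= big_nat1 eseries0 ?adde0//= => -[|k]//= _ _; congr EFin.
by rewrite /box_volume big_ord_recl mxE subrr mul0r.
Qed.

Lemma Hn_set0 : Hn (set0 : set V) = 0%E.
Proof.
apply/eqP; rewrite eq_le Hn_ge0 andbT.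
apply: le_trans (le_Hn (@sub0set _ (box 0 0))) _.
apply: le_trans (Hn_box_le _) _ => [i|]; first by rewrite lexx.
by rewrite /box_volume big_ord_recl mxE subrr mul0r.
Qed.

HB.instance Definition _ := isOuterMeasure.Build R V (@Hn R n.+1)
  Hn_set0 Hn_ge0 le_Hn Hn_sigma_subadditive.

(** As Hn is built from covers by boxes, a bound on the images of boxes
    propagates to the images of all sets. *)
Lemma Hn_image_le (f : V -> V) (c : R) : 0 < c ->
  (forall a b, (forall i, a ord0 i <= b ord0 i) ->
    (Hn (f @` box a b) <= (c * box_volume a b)%:E)%E) ->
  forall A, (Hn (f @` A) <= c%:E * Hn A)%E.
Proof.
move=> c0 fbox A; rewrite -lee_pdivrMl//.
apply: le_ereal_inf_tmp => _ [a [b [[ab Asub] ->]]].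
rewrite lee_pdivrMl// -nneseriesZl; last first.
  by move=> k _; rewrite lee_fin box_volume_ge0.
apply: (@le_trans _ _ (Hn (\bigcup_k (f @` box (a k) (b k))))).
  apply: le_Hn; rewrite -image_bigcup; exact: image_subset.
apply: le_trans (Hn_sigma_subadditive _) _.
apply: lee_nneseries => [k _ _|k _]; first exact: Hn_ge0.
by rewrite -EFinM; exact: fbox.
Qed.

Lemma Hn_homothety_le v (l : R) A : 0 < l ->
  (Hn ((fun x => (v + l *: x)%R) @` A) <= (l ^+ n.+1)%:E * Hn A)%E.
Proof.
move=> l0; apply: Hn_image_le => [|a b ab]; first exact: exprn_gt0.
pose f x := v + l *: x.
apply: (@le_trans _ _ (Hn (box (f a) (f b)))).
  apply: le_Hn => _ [x abx <-] i; rewrite !mxE.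
  have /andP[xa xb] := abx i.
  by rewrite ltrD2l lerD2l ltr_pM2l// ler_pM2l// xa.
apply: le_trans (Hn_box_le _) _ => [i|].
  by rewrite !mxE lerD2l ler_pM2l.
rewrite lee_fin /box_volume -[X in l ^+ X]card_ord -prodr_const -big_split /=.
apply: ler_prod => i _; rewrite !mxE opprD addrACA subrr add0r -mulrBr.
by rewrite lexx andbT mulr_ge0 ?subr_ge0// ltW.
Qed.

Lemma Hn_homothety v (l : R) A : 0 < l ->
  Hn ((fun x => v + l *: x) @` A) = ((l ^+ n.+1)%:E * Hn A)%E.
Proof.
move=> l0; apply/eqP; rewrite eq_le Hn_homothety_le//=.
rewrite -lee_pdivlMl ?exprn_gt0// -exprVn.
have := @Hn_homothety_le (- (l^-1 *: v)) l^-1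
  ((fun x => v + l *: x) @` A).
rewrite invr_gt0 => /(_ l0); congr (_ <= _)%E; congr (Hn _).
rewrite image_comp -[RHS]image_id; apply: eq_imagel => x _ /=.
by rewrite scalerDr addrA addNr add0r scalerA mulVf ?scale1r// gt_eqF.
Qed.

Lemma Hn_translation v A : Hn ((fun x => v + x) @` A) = Hn A.
Proof.
have := @Hn_homothety v 1 A ltr01; rewrite expr1n mul1e => <-.
by congr (Hn _); apply: eq_imagel => x _; rewrite scale1r.
Qed.

Local Notation measurable := (caratheodory_measurable (@Hn R n.+1)).

(** A coordinate hyperplane cuts each box of a cover into two boxes whose volumes
    add up to the original one. *)
Lemma measurable_coord_le (i : 'I_n.+1) (c : R) :
  measurable [set x : V | x ord0 i <= c].
Proof.
apply: le_caratheodory_measurable => X; set H := [set x | _].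
apply: le_ereal_inf_tmp => _ [a [b [[ab Xsub] ->]]].
(* The cutting height is clamped to the k-th box, so that one of the two pieces
   may be degenerate but both have ordered corners. *)
pose m k := Num.max (a k ord0 i) (Num.min (b k ord0 i) c).
pose upd (w : V) (t : R) : V := \row_j if j == i then t else w ord0 j.
have am k : a k ord0 i <= m k by rewrite le_max lexx.
have mb k : m k <= b k ord0 i by rewrite ge_max ab ge_min lexx.
have lo_ok k j : a k ord0 j <= upd (b k) (m k) ord0 j.
  by rewrite mxE; case: eqP => [->|].
have hi_ok k j : upd (a k) (m k) ord0 j <= b k ord0 j.
  by rewrite mxE; case: eqP => [->|].
have split_vol k : box_volume (a k) (b k) =
    box_volume (a k) (upd (b k) (m k)) + box_volume (upd (a k) (m k)) (b k).
  have prodD (F : 'I_n.+1 -> R) : \prod_j F j = F i * \prod_(j | j != i) F j.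
    exact: bigD1.
  rewrite /box_volume !prodD !mxE eqxx.
  rewrite [X in _ = _ * X + _](eq_bigr (fun j => b k ord0 j - a k ord0 j)).
    rewrite [X in _ = _ + _ * X](eq_bigr (fun j => b k ord0 j - a k ord0 j)).
      by ring.
    by move=> j /negPf ji; rewrite !mxE ji.
  by move=> j /negPf ji; rewrite !mxE ji.
have -> : (\sum_(k <oo) (box_volume (a k) (b k))%:E =
    \sum_(k <oo) (box_volume (a k) (upd (b k) (m k)))%:E +
    \sum_(k <oo) (box_volume (upd (a k) (m k)) (b k))%:E)%E.
  rewrite -nneseriesD; first by apply: eq_eseriesr => k _; rewrite split_vol EFinD.
    by move=> k _ _; rewrite lee_fin box_volume_ge0.
  by move=> k _ _; rewrite lee_fin box_volume_ge0.
apply: leeD; apply: Hn_le_cover; split=> // x [Xx xi];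
  have [k _ abx] := Xsub _ Xx; exists k => // j; have := abx j; rewrite mxE;
  case: eqP => // -> /andP[ax xb].
  by rewrite ax le_max le_min xb; apply/orP; right.
rewrite xb andbT /m maxElt; case: ifP => // _.
by rewrite gt_min; apply/orP; right; rewrite ltNge; apply/negP.
Qed.

Lemma measurable_box a b : measurable (box a b).
Proof.
have -> : box a b = ~` \bigcup_(k : nat) ~` ([set x | x ord0 (inord k) <= b ord0 (inord k)]
    `&` ~` [set x | x ord0 (inord k) <= a ord0 (inord k)]).
  rewrite setC_bigcup; apply/seteqP; split=> x abx.
    move=> k _; rewrite setCK; have /andP[ax xb] := abx (inord k).
    by split=> //=; apply/negP; rewrite -ltNge.
  move=> i; have := abx i I; rewrite setCK inord_val => -[/= -> /negP].
  by rewrite -ltNge => ->.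
apply: caratheodory_measurable_setC; apply: caratheodory_measurable_bigcup => k.
apply: caratheodory_measurable_setC; apply: caratheodory_measurable_setI.
  exact: measurable_coord_le.
by apply: caratheodory_measurable_setC; exact: measurable_coord_le.
Qed.

Definition rat_box (k : nat) : set V :=
  if unpickle k is Some (q, m) then
    box (map_mx ratr q - const_mx m.+1%:R^-1) (map_mx ratr q + const_mx m.+1%:R^-1)
  else set0.

(** The boxes [rat_box k] form a countable base: they reduce statements about open
    sets to countable unions. *)
Lemma rat_box_nbhs x (U : set V) : nbhs x U ->
  exists k, rat_box k x /\ rat_box k `<=` U.
Proof.
move=> /nbhs_ballP[e /= e0 eU].
pose m := Num.trunc (2 / e); pose d : R := m.+1%:R^-1.
have d0 : 0 < d by rewrite invr_gt0.
have de : d + d < e.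
  have : 2 / e < m.+1%:R by rewrite -truncn_le_nat.
  rewrite ltr_pdivrMr// => h.
  by rewrite -mulr2n -mulr_natl ltr_pdivrMr// mulrC.
have /choice[q qP] : forall i, exists q : rat, x ord0 i - d < ratr q < x ord0 i + d.
  move=> i; have [|q] := @rat_in_itvoo R (x ord0 i - d) (x ord0 i + d).
    by rewrite ltrBlDr -addrA ltrDl addr_gt0.
  by rewrite in_itv/=; exists q.
exists (pickle (\row_i q i : 'rV[rat]_n.+1, m)); rewrite /rat_box pickleK; split.
  move=> i; rewrite !mxE -/d; have /andP[h1 h2] := qP i; apply/andP; split; lra.
move=> y yb; apply: eU; split=> // i j; rewrite [i]ord1 /ball /= ltr_norml.
have := yb j; rewrite !mxE -/d => /andP[h1 h2].
have /andP[h3 h4] := qP j; apply/andP; split; lra.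
Qed.

Lemma measurable_open (U : set V) : open U -> measurable U.
Proof.
rewrite openE => Uo.
have -> : U = \bigcup_k (if `[< rat_box k `<=` U >] then rat_box k else set0).
  apply/seteqP; split=> [x Ux|x [k _]].
    have [k [kx kU]] := rat_box_nbhs (Uo _ Ux).
    by exists k => //; case: asboolP.
  by case: asboolP => // kU /kU.
apply: caratheodory_measurable_bigcup => k.
case: asboolP => _; last exact: caratheodory_measurable_set0.
rewrite /rat_box; case: unpickle => [[q m]|]; first exact: measurable_box.
exact: caratheodory_measurable_set0.
Qed.

Lemma measurable_closed (F : set V) : closed F -> measurable F.
Proof.
by move=> Fc; rewrite -[F]setCK; apply: caratheodory_measurable_setC;
  apply: measurable_open; exact: closed_openC.
Qed.

(** Countably many boxes of the base with null trace already cover the set. *)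
Lemma Hn_locally_null A :
  (forall x, A x -> exists2 U, nbhs x U & Hn (U `&` A) = 0%E) -> Hn A = 0%E.
Proof.
move=> loc; apply/eqP; rewrite eq_le Hn_ge0 andbT.
pose N k := if `[< Hn (rat_box k `&` A) = 0%E >] then rat_box k `&` A else set0.
apply: (@le_trans _ _ (Hn (\bigcup_k N k))).
  apply: le_Hn => x Ax; have [U xU UA] := loc x Ax.
  have [k [kx kU]] := rat_box_nbhs xU; exists k => //.
  rewrite /N asboolT//; apply/eqP; rewrite eq_le Hn_ge0 andbT -UA.
  by apply: le_Hn; exact: setSI.
apply: le_trans (Hn_sigma_subadditive _) _.
rewrite eseries0// => k _ _; rewrite /N; case: asboolP => // _.
Qed.

Lemma Hn_eq0_sub A B : A `<=` B -> Hn B = 0%E -> Hn A = 0%E.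
Proof.
by move=> AB B0; apply/eqP; rewrite eq_le Hn_ge0 andbT -B0 le_Hn.
Qed.

Lemma HnU A B : (Hn (A `|` B) <= Hn A + Hn B)%E.
Proof. exact: outer_measureU2. Qed.

Lemma Hn_eq0_U A B : Hn A = 0%E -> Hn B = 0%E -> Hn (A `|` B) = 0%E.
Proof.
move=> A0 B0; apply/eqP; rewrite eq_le Hn_ge0 andbT.
by apply: le_trans (HnU _ _) _; rewrite A0 B0 adde0.
Qed.

End lebesgue_outer_measure.

(** * The outer measure of a box *)

Section volume_of_boxes.
Context {R : realType}.

(** By induction on the dimension. The slice of the box at height t of the first
    coordinate is covered by the slices of those boxes whose first side contains t;
    integrating the induction hypothesis over t with respect to one-dimensional
    Lebesgue measure multiplies each volume by the length of its first side. The set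
    [P] of indices is there because only some of the boxes meet a given slice, and a
    discarded box cannot be replaced by a null one in dimension 0. *)
Lemma box_volume_le_cover n (a b : 'rV[R]_n) (c d : nat -> 'rV[R]_n)
    (P : set nat) :
  (forall i, a ord0 i <= b ord0 i) ->
  (forall k i, c k ord0 i <= d k ord0 i) ->
  box a b `<=` \bigcup_(k in P) box (c k) (d k) ->
  ((box_volume a b)%:E <=
     \sum_(k <oo) (\1_P k * box_volume (c k) (d k))%:E)%E.
Proof.
elim: n a b c d P => [|n IH] a b c d P ab cd sub.
  have term_ge0 k : (0 <= (\1_P k * box_volume (c k) (d k))%:E)%E.
    by rewrite lee_fin mulr_ge0// box_volume_ge0.
  have [k Pk _] : (\bigcup_(k in P) box (c k) (d k)) a by apply: sub => -[].
  rewrite (@nneseriesD1 _ _ k)//.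
  rewrite [box_volume a b]big_ord0 /box_volume big_ord0 indicE mem_set// mulr1.
  by rewrite leeDl//; apply: nneseries_ge0 => i _ _; exact: term_ge0.
pose tl (x : 'rV[R]_n.+1) : 'rV[R]_n := \row_j x ord0 (lift ord0 j).
have volE (x y : 'rV[R]_n.+1) :
    box_volume x y = (y ord0 ord0 - x ord0 ord0) * box_volume (tl x) (tl y).
  rewrite /box_volume big_ord_recl; congr (_ * _).
  by apply: eq_bigr => j _; rewrite !mxE.
have tl_le (x y : 'rV[R]_n.+1) : (forall i, x ord0 i <= y ord0 i) ->
  forall i, tl x ord0 i <= tl y ord0 i by move=> xy i; rewrite !mxE.
pose I k : set (measurableTypeR R) := `]c k ord0 ord0, d k ord0 ord0]%classic.
pose w k := \1_P k * box_volume (tl (c k)) (tl (d k)).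
have w_ge0 k : 0 <= w k.
  by rewrite mulr_ge0// box_volume_ge0//; exact: tl_le.
pose D : set (measurableTypeR R) := `]a ord0 ord0, b ord0 ord0]%classic.
pose mu := @lebesgue_measure R.
have mI k : measurable (I k) by exact: measurable_itv.
have mD : measurable D by exact: measurable_itv.
have slice t : D t ->
    ((box_volume (tl a) (tl b))%:E <= \sum_(k <oo) (w k * \1_(I k) t)%:E)%E.
  move=> Dt; apply: le_trans
    (IH _ _ (tl \o c) (tl \o d) (P `&` [set k | I k t]) (tl_le _ _ ab) _ _) _.
  - by move=> k i; exact: (tl_le _ _ (cd k)).
  - move=> x abx.
    pose x' : 'rV[R]_n.+1 := \row_j if unlift ord0 j is Some i then x ord0 i else t.
    have [k Pk xk] : (\bigcup_(k in P) box (c k) (d k)) x'.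
      apply: sub => j; rewrite mxE; case: unliftP => [i ->|->].
        by have := abx i; rewrite !mxE.
      by move: Dt; rewrite /D /= in_itv.
    exists k; first by split=> //; have := xk ord0; rewrite mxE unlift_none /I/= in_itv.
    by move=> i; have := xk (lift ord0 i); rewrite !mxE liftK.
  - apply: lee_nneseries => [k _ _|k _].
      by rewrite lee_fin mulr_ge0// box_volume_ge0// => i; apply: tl_le.
    by rewrite lee_fin /w indicI /= mulrAC.
rewrite volE mulrC.
have -> : (box_volume (tl a) (tl b) * (b ord0 ord0 - a ord0 ord0))%:E =
    (\int[mu]_(t in D) (box_volume (tl a) (tl b))%:E)%E.
  rewrite integral_cst// EFinM; congr (_ * _)%E.
  by rewrite /mu/= lebesgue_measure_itv/= lte_fin; case: ltgtP (ab ord0) => // ->; rewrite subrr.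
apply: (@le_trans _ _ (\int[mu]_(t in D) \sum_(k <oo) (w k * \1_(I k) t)%:E)%E).
  apply: ge0_le_integral => //.
  - by move=> t _; rewrite lee_fin box_volume_ge0//; exact: tl_le.
  - apply: (@ge0_emeasurable_sum _ _ _ _ _ xpredT) => k.
      by move=> t _ _; rewrite lee_fin mulr_ge0.
    by move=> _; apply/measurable_EFinP; apply: measurable_funM => //;
      exact: measurable_indic.
rewrite integral_nneseries//; last 2 first.
- by move=> k; apply/measurable_EFinP; apply: measurable_funM => //;
    exact: measurable_indic.
- by move=> k t _; rewrite lee_fin mulr_ge0.
apply: lee_nneseries => [k _ _|k _].
  by apply: integral_ge0 => t _; rewrite lee_fin mulr_ge0.
under eq_integral do rewrite EFinM.
rewrite ge0_integralZl//; last 2 first.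
- by apply/measurable_EFinP; exact: measurable_indic.
- by rewrite lee_fin.
rewrite integral_indic//.
have -> : ((\1_P k * box_volume (c k) (d k))%:E =
    (w k)%:E * (d k ord0 ord0 - c k ord0 ord0)%:E)%E.
  by rewrite -EFinM /w volE; congr EFin; ring.
apply: lee_wpmul2l; first by rewrite lee_fin.
apply: le_trans (le_measure _ _ _ (@subIsetl _ (I k) D)) _; rewrite ?inE//.
  exact: measurableI.
rewrite /mu /= lebesgue_measure_itv/= lte_fin.
by case: ltgtP (cd k ord0) => // ->; rewrite subrr.
Qed.

Lemma Hn_box n (a b : 'rV[R]_n.+1) : (forall i, a ord0 i <= b ord0 i) ->
  Hn (box a b) = (box_volume a b)%:E.
Proof.
move=> ab; apply/eqP; rewrite eq_le Hn_box_le//=.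
apply: le_ereal_inf_tmp => _ [c [d [[cd sub] ->]]].
have := @box_volume_le_cover _ a b c d setT ab cd sub.
by under eq_eseriesr do rewrite indicT mul1r.
Qed.

Lemma Hn_nbhs_gt0 n (x : 'rV[R]_n.+1) (U : set 'rV[R]_n.+1) :
  nbhs x U -> (0 < Hn U)%E.
Proof.
move=> /nbhs_ballP[e /= e0 eU].
have e20 : 0 < e / 2 by rewrite divr_gt0.
pose a : 'rV[R]_n.+1 := x - const_mx (e / 2).
have ax i : a ord0 i <= x ord0 i by rewrite !mxE; lra.
apply: (@lt_le_trans _ _ (Hn (box a x))).
  rewrite Hn_box// lte_fin prodr_gt0// => i _; rewrite !mxE; lra.
apply: le_Hn => y axy; apply: eU; split=> // i j; rewrite [i]ord1 /ball /= ltr_norml.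
by have := axy j; rewrite !mxE => /andP[? ?]; apply/andP; split; lra.
Qed.

End volume_of_boxes.

(** * Euclidean balls *)

Section euclidean_space.
Context {R : realType} {n : nat}.
Local Notation V := 'rV[R]_n.
Implicit Types (x y z u : V) (r t : R).

Lemma dotpC x y : dotp x y = dotp y x.
Proof. by apply: eq_bigr => i _; rewrite mulrC. Qed.

Lemma dotpDl x y z : dotp (x + y) z = dotp x z + dotp y z.
Proof. by rewrite -big_split; apply: eq_bigr => i _; rewrite mxE mulrDl. Qed.

Lemma dotpZl t x y : dotp (t *: x) y = t * dotp x y.
Proof. by rewrite mulr_sumr; apply: eq_bigr => i _; rewrite mxE mulrA. Qed.

Lemma dotpNl x y : dotp (- x) y = - dotp x y.
Proof. by rewrite -scaleN1r dotpZl mulN1r. Qed.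

Lemma dotpDr x y z : dotp z (x + y) = dotp z x + dotp z y.
Proof. by rewrite dotpC dotpDl !(dotpC z). Qed.

Lemma dotpZr t x y : dotp y (t *: x) = t * dotp y x.
Proof. by rewrite dotpC dotpZl dotpC. Qed.

Lemma dotpNr x y : dotp y (- x) = - dotp y x.
Proof. by rewrite dotpC dotpNl dotpC. Qed.

Lemma dotp_sumr (I : finType) x (w : I -> V) :
  dotp x (\sum_i w i) = \sum_i dotp x (w i).
Proof.
rewrite exchange_big; apply: eq_bigr => j _.
by rewrite summxE mulr_sumr.
Qed.

Definition dotpE := (dotpDl, dotpDr, dotpZl, dotpZr, dotpNl, dotpNr).

Lemma dotpxx_ge0 x : 0 <= dotp x x.
Proof. by apply: sumr_ge0 => i _; rewrite -expr2 sqr_ge0. Qed.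

Lemma enorm_ge0 x : 0 <= enorm x. Proof. exact: sqrtr_ge0. Qed.

Lemma enorm_sqr x : enorm x ^+ 2 = dotp x x.
Proof. by rewrite sqr_sqrtr// dotpxx_ge0. Qed.

Lemma enorm_leP x r : 0 <= r -> (enorm x <= r) = (dotp x x <= r ^+ 2).
Proof. by move=> r0; rewrite -enorm_sqr ler_sqr ?nnegrE// enorm_ge0. Qed.

Lemma enorm0 : enorm (0 : V) = 0.
Proof. by rewrite -(scale0r (0 : V)) /enorm dotpZl mul0r sqrtr0. Qed.

Lemma enormN x : enorm (- x) = enorm x.
Proof. by rewrite /enorm dotpNl dotpNr opprK. Qed.

Lemma enormZ t x : enorm (t *: x) = `|t| * enorm x.
Proof.
by rewrite /enorm dotpZl dotpZr mulrA sqrtrM -?expr2 ?sqr_ge0// sqrtr_sqr.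
Qed.

Lemma dotp_le x y : dotp x y <= enorm x * enorm y.
Proof.
have [yy0|yy0] := eqVneq (dotp y y) 0.
  suff -> : dotp x y = 0 by rewrite mulr_ge0 ?enorm_ge0.
  apply: big1 => i _; suff -> : y ord0 i = 0 by rewrite mulr0.
  move/eqP: yy0; rewrite psumr_eq0; last by move=> j _; rewrite -expr2 sqr_ge0.
  by move=> /allP/(_ i (mem_index_enum _)); rewrite -expr2 sqrf_eq0 => /eqP.
have yy_gt0 : 0 < dotp y y by rewrite lt_neqAle eq_sym yy0 dotpxx_ge0.
rewrite -sqrtrM ?dotpxx_ge0//; apply: le_trans (ler_norm _) _.
rewrite -sqrtr_sqr ler_wsqrtr//.
(* Cauchy-Schwarz: up to a factor, this vector is the component of x orthogonal
   to y. *)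
have := dotpxx_ge0 (dotp y y *: x - dotp x y *: y).
rewrite !dotpE (dotpC y x) => h.
by rewrite -(ler_pM2l yy_gt0); nra.
Qed.

Lemma enormD x y : enorm (x + y) <= enorm x + enorm y.
Proof.
rewrite enorm_leP ?addr_ge0 ?enorm_ge0// !dotpE (dotpC y x) sqrrD !enorm_sqr.
by have := dotp_le x y; lra.
Qed.

Lemma coord_le_enorm x i : `|x ord0 i| <= enorm x.
Proof.
rewrite -sqrtr_sqr ler_wsqrtr// expr2 /dotp (bigD1 i)//= lerDl.
by apply: sumr_ge0 => j _; rewrite -expr2 sqr_ge0.
Qed.

Lemma dotp_continuous y : continuous (fun x => dotp x y).
Proof.
apply: continuous_big => [|i _ x]; first exact: add_continuous.
by exact: (continuousM (@coord_continuous _ _ _ _ _ x) (@cst_continuous _ _ _ x)).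
Qed.

Lemma enormB_continuous y : continuous (fun x => enorm (x - y)).
Proof.
move=> x; apply: (@continuous_comp _ _ _ (fun z => dotp (z - y) (z - y)) Num.sqrt);
  last exact: sqrt_continuous.
move: x; apply: continuous_big => [|i _ x]; first exact: add_continuous.
have -> : (fun M : V => (M - y) ord0 i * (M - y) ord0 i) =
    (fun M : V => (M ord0 i - y ord0 i) * (M ord0 i - y ord0 i)).
  by apply/funext => M; rewrite !mxE.
have cB : {for x, continuous (fun M : V => M ord0 i - y ord0 i)}.
  by exact: (continuousB (@coord_continuous _ _ _ _ _ x) (@cst_continuous _ _ _ x)).
exact: (continuousM cB cB).
Qed.

Lemma cball_closed y r : closed (cball y r).
Proof.
apply: (@preimage_closed _ _ (fun x => enorm (x - y)) [set s | s <= r]).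
  by move=> x _; exact: enormB_continuous.
exact: closed_le.
Qed.

Lemma cball_nbhs y r : 0 < r -> nbhs y (cball y r).
Proof.
move=> r0; apply: (@enormB_continuous y y [set s | s <= r]) => /=.
by rewrite subrr enorm0; apply: filterS (lt_nbhsl r0) => s /ltW.
Qed.

Lemma nbhs_cball y (U : set V) : nbhs y U -> exists2 r, 0 < r & cball y r `<=` U.
Proof.
move=> /nbhs_ballP[e /= e0 eU]; exists (e / 2); first by rewrite divr_gt0.
move=> x xy; apply: eU; split => // i j; rewrite [i]ord1 /ball/= distrC.
have := coord_le_enorm (x - y) j; rewrite !mxE => /le_lt_trans; apply.
by apply: le_lt_trans xy _; lra.
Qed.

Lemma cball_compact y r : compact (cball y r).
Proof.
apply: bounded_closed_compact; last exact: cball_closed.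
exists (enorm y + r); split; first exact: num_real.
move=> M yrM x xy; rewrite /Num.norm/= mx_normrE; apply: bigmax_le => [|[i j] _ /=].
  by apply: le_trans (ltW yrM); rewrite addr_ge0 ?enorm_ge0// (le_trans (enorm_ge0 _) xy).
rewrite [i]ord1; apply: le_trans (coord_le_enorm _ _) _.
apply: le_trans (ltW yrM); rewrite -{1}(subrK y x) [leRHS]addrC.
by apply: le_trans (enormD _ _) _; rewrite lerD2r.
Qed.

Lemma convex_setP (A : set V) : convex_set A <->
  forall x y t, 0 <= t -> t <= 1 -> A x -> A y -> A (t *: x + (1 - t) *: y).
Proof.
split=> [cA x y t t0 t1 Ax Ay|cA x y l]; last first.
  by rewrite !inE => Ax Ay; apply: cA.
by have := cA x y (Itv01 t0 t1); rewrite !inE; apply.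
Qed.

Lemma cball_convex y r : convex_set (cball y r).
Proof.
apply/convex_setP => x z t t0 t1 xy zy; rewrite /cball /=.
have -> : t *: x + (1 - t) *: z - y = t *: (x - y) + (1 - t) *: (z - y).
  by apply/rowP => i; rewrite !mxE; ring.
apply: le_trans (enormD _ _) _; rewrite !enormZ !ger0_norm ?subr_ge0//.
rewrite /cball /= in xy zy; nra.
Qed.

Lemma cball_convex_body y r : 0 < r -> convex_bodies (cball y r).
Proof.
move=> r0; split; last by exists y; exact: cball_nbhs.
split; [|exact: cball_compact|exact: cball_convex].
by exists y; rewrite /cball/= subrr enorm0 ltW.
Qed.

End euclidean_space.

(** * Comparing measures on cubes *)

Section images_of_cubes.
Context {R : realType} {n : nat}.
Local Notation V := 'rV[R]_n.+1.
Implicit Types (a b v x : V) (A : set V).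

Definition cube v (l : R) : set V := box v (v + const_mx l).

Lemma Hn_bigU (I : Type) (s : seq I) (P : pred I) (F : I -> set V) :
  (Hn (\big[setU/set0]_(i <- s | P i) F i) <= \sum_(i <- s | P i) Hn (F i))%E.
Proof.
elim/big_ind2 : _ => [|A x B y Ax By|//]; first by rewrite Hn_set0.
by apply: le_trans (HnU _ _) _; exact: leeD.
Qed.

Lemma natr_cell (s : R) : 0 < s -> exists k : nat, k%:R < s <= k.+1%:R.
Proof.
move=> s0; have [|m sm mmin] := @ex_minnP (fun k : nat => s <= k%:R).
  by exists (Num.trunc s).+1; apply: ltW; rewrite -truncn_le_nat.
case: m => [|k] in sm mmin; first by move: s0; rewrite ltNge sm.
exists k; rewrite sm andbT ltNge; apply/negP => /mmin.
by rewrite ltnn.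
Qed.

(** Cut the box into a grid of cubes of side [d]; the last layer may stick out, which
    costs at most one more [d] in each direction. *)
Lemma Hn_image_box_le (f : V -> V) (c d : R) a b : 0 <= c -> 0 < d ->
  (forall v, (Hn (f @` cube v d) <= (c * d ^+ n.+1)%:E)%E) ->
  (forall i, a ord0 i <= b ord0 i) ->
  (Hn (f @` box a b) <= (c * \prod_i (b ord0 i - a ord0 i + d))%:E)%E.
Proof.
move=> c0 d0 fcube ab.
pose N i := (Num.trunc ((b ord0 i - a ord0 i) / d)).+1.
have Nd i : (N i)%:R * d <= b ord0 i - a ord0 i + d.
  rewrite -natr1 mulrDl mul1r lerD2r -ler_pdivlMr//.
  by rewrite truncn_le// divr_ge0 ?subr_ge0// ltW.
pose M := \max_i N i.
(* The grid cells are indexed by functions into a common bound M on the numbers of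
   layers; P selects those that are needed. *)
pose corner (g : {ffun 'I_n.+1 -> 'I_M}) : V := \row_i (a ord0 i + (g i)%:R * d).
pose P (g : {ffun 'I_n.+1 -> 'I_M}) := [forall i, (g i < N i)%N].
apply: (@le_trans _ _ (Hn (\big[setU/set0]_(g | P g) (f @` cube (corner g) d)))).
  apply: le_Hn => _ [x abx <-].
  have /choice[k kP] i : exists k : nat,
      (k < N i)%N /\ k%:R < (x ord0 i - a ord0 i) / d <= k.+1%:R.
    have /andP[ax xb] := abx i.
    have [|k kx] := @natr_cell ((x ord0 i - a ord0 i) / d).
      by rewrite divr_gt0 ?subr_gt0.
    exists k; split=> //; rewrite -(ltr_nat R).
    have /andP[/lt_trans + _] := kx; apply.
    apply: (@le_lt_trans _ _ ((b ord0 i - a ord0 i) / d)).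
      by rewrite ler_pM2r ?invr_gt0// lerD2r.
    by rewrite -truncn_le_nat.
  have kM i : (k i < M)%N by apply: leq_trans (kP i).1 _; exact: leq_bigmax.
  pose g := [ffun i => Ordinal (kM i)].
  rewrite (bigD1 g)/=; last by apply/forallP => i; rewrite ffunE; exact: (kP i).1.
  left; exists x => // i; rewrite !mxE ffunE /=.
  have /andP[k1 k2] := (kP i).2; move: k1 k2.
  rewrite ltr_pdivlMr// ler_pdivrMr// -natr1 mulrDl mul1r => k1 k2.
  by apply/andP; split; lra.
apply: le_trans (Hn_bigU _ _ _) _.
apply: (@le_trans _ _ (\sum_(g | P g) (c * d ^+ n.+1)%:E)%E).
  by apply: lee_sum => g _; exact: fcube.
rewrite sumEFin lee_fin -mulr_sumr ler_wpM2l//.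
(* Distribute the product of the numbers of layers over the cells. *)
have -> : \sum_(g | P g) d ^+ n.+1 = \prod_i \sum_(j < M) (if (j < N i)%N then d else 0).
  rewrite bigA_distr_bigA big_mkcond /=; apply: eq_bigr => g _.
  case: ifPn => [/forallP Pg|]; last first.
    by rewrite negb_forall => /existsP[i /negPf gi]; rewrite (bigD1 i)//= gi mul0r.
  rewrite (eq_bigr (fun=> d)) ?prodr_const ?card_ord// => i _.
  by rewrite Pg.
apply: ler_prod => i _; rewrite -big_mkcond -(big_ord_widen _ (fun=> d)) ?leq_bigmax//.
by rewrite sumr_const card_ord -mulr_natl Nd mulr_ge0// ltW.
Qed.

(** Let the mesh of the grid tend to 0. *)
Lemma Hn_image_le_of_cubes (f : V -> V) (c : R) : 0 < c ->
  (forall v l, 0 < l -> (Hn (f @` cube v l) <= (c * l ^+ n.+1)%:E)%E) ->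
  forall A, (Hn (f @` A) <= c%:E * Hn A)%E.
Proof.
move=> c0 fcube; apply: Hn_image_le => // a b ab.
pose p (d : R) := c * \prod_i (b ord0 i - a ord0 i + d).
have p_cont : continuous p.
  move=> x; apply: continuousM; first exact: cst_continuous.
  move: x; apply: continuous_big => [|i _ x]; first exact: mul_continuous.
  exact: (continuousD (@cst_continuous _ _ _ x) (@cvg_id _ (nbhs x))).
have p0 : p 0 = c * box_volume a b.
  by congr (_ * _); apply: eq_bigr => i _; rewrite addr0.
apply/lee_addgt0Pr => e e0.
have : \forall d \near 0, p d < p 0 + e.
  by apply: (p_cont 0 [set y | y < p 0 + e]); apply: lt_nbhsl; rewrite ltrDl.
move=> /nbhs_ballP[r /= r0 /(_ (r / 2)) pr].
apply: (@le_trans _ _ (p (r / 2))%:E).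
  apply: Hn_image_box_le => //; first exact: ltW.
    by rewrite divr_gt0.
  by move=> v; apply: fcube; rewrite divr_gt0.
rewrite -p0 -EFinD lee_fin; apply/ltW/pr.
by rewrite /ball /= sub0r normrN ger0_norm ?divr_ge0 ?ltW//; lra.
Qed.
End images_of_cubes.

(** * Invariance under reflections *)

Section reflections.
Context {R : realType} {n : nat}.
Local Notation V := 'rV[R]_n.
Variable u : V.
Implicit Types (x y : V) (A B : set V) (t : R).

Lemma reflectionD x y : reflection u (x + y) = reflection u x + reflection u y.
Proof. by apply/rowP => i; rewrite !mxE dotpDl; ring. Qed.

Lemma reflectionZ t x : reflection u (t *: x) = t *: reflection u x.
Proof. by apply/rowP => i; rewrite !mxE dotpZl; ring. Qed.

Lemma reflection0 : reflection u 0 = 0.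
Proof. by rewrite -[in LHS](scale0r (0 : V)) reflectionZ !scale0r. Qed.

Lemma reflectionB x y : reflection u (x - y) = reflection u x - reflection u y.
Proof. by rewrite reflectionD -scaleN1r reflectionZ scaleN1r. Qed.

Lemma reflection_continuous : continuous (reflection u).
Proof.
move=> x; apply: (continuousB (@cvg_id _ (nbhs x))).
apply: (@continuousZ _ _ _ (fun y => 2 * dotp y u) (fun=> u)); last exact: cst_continuous.
exact: (continuousM (@cst_continuous _ _ _ x) (@dotp_continuous _ _ _ x)).
Qed.

Hypothesis hu : enorm u = 1.

Lemma dotp_unit : dotp u u = 1.
Proof. by rewrite -enorm_sqr hu expr1n. Qed.

Lemma dotp_reflectionl x : dotp (reflection u x) u = - dotp x u.
Proof. by rewrite /reflection !dotpE dotp_unit; ring. Qed.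

Lemma reflectionK : involutive (reflection u).
Proof.
by move=> x; rewrite {1}/reflection dotp_reflectionl; apply/rowP => i;
  rewrite !mxE; ring.
Qed.

Lemma enorm_reflection x : enorm (reflection u x) = enorm x.
Proof.
congr Num.sqrt; rewrite /reflection !dotpE (dotpC u x) dotp_unit; ring.
Qed.

Lemma reflection_setE A : reflection_set u A = reflection u @^-1` A.
Proof.
apply/seteqP; split=> [_ [x Ax <-]|x Ax]; rewrite /preimage/= ?reflectionK//.
by exists (reflection u x); rewrite ?reflectionK.
Qed.

Lemma reflection_setK : involutive (reflection_set u).
Proof.
move=> A; rewrite !reflection_setE; apply/seteqP.
by split=> x; rewrite /preimage/= reflectionK.
Qed.

Lemma reflection_cball y r :
  reflection_set u (cball y r) = cball (reflection u y) r.
Proof.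
rewrite reflection_setE; apply/seteqP; split=> x;
  rewrite /cball /preimage/= -enorm_reflection reflectionB ?reflectionK//.
Qed.

End reflections.

Section reflection_invariance.
Context {R : realType} {n : nat}.
Local Notation V := 'rV[R]_n.+1.
Implicit Types (x v : V) (A : set V).

Lemma Hn_cube v (l : R) : 0 <= l -> Hn (cube v l) = (l ^+ n.+1)%:E.
Proof.
move=> l0; rewrite /cube Hn_box => [|i]; last by rewrite !mxE lerDl.
rewrite /box_volume (eq_bigr (fun=> l)) ?prodr_const ?card_ord// => i _.
by rewrite !mxE addrAC subrr add0r.
Qed.

Lemma cball_sub_cube x (r : R) : 0 < r ->
  cball x r `<=` cube (x - const_mx (2 * r)) (4 * r).
Proof.
move=> r0 y xy i; have := le_trans (coord_le_enorm (y - x) i) xy.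
by rewrite !mxE ler_norml => /andP[h1 h2]; apply/andP; split; lra.
Qed.

Lemma Hn_cball_fin x (r : R) : (Hn (cball x r) < +oo)%E.
Proof.
have r'0 : 0 < `|r| + 1 by apply: ltr_wpDl.
have rr' : cball x r `<=` cball x (`|r| + 1).
  by move=> y /= /le_trans; apply; apply: le_trans (ler_norm r) _; rewrite lerDl.
apply: le_lt_trans (le_Hn rr') _.
apply: le_lt_trans (le_Hn (cball_sub_cube r'0)) _.
by rewrite Hn_cube ?ltry// mulr_ge0// ltW.
Qed.

Lemma cubeE v (l : R) : 0 < l -> cube v l = (fun x => v + l *: x) @` cube 0 1.
Proof.
move=> l0; apply/seteqP; split=> [x xv|_ [x xQ <-] i]; last first.
  have := xQ i; rewrite !mxE !add0r => /andP[x0 x1].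
  by rewrite ltrDl lerD2l mulr_gt0// ger_pMr.
exists (l^-1 *: (x - v)); last first.
  by rewrite scalerA divff ?gt_eqF// scale1r addrC subrK.
move=> i; have := xv i; rewrite !mxE add0r mulrC => /andP[vx xvl].
by rewrite divr_gt0 ?subr_gt0//= ler_pdivrMr// mul1r lerBlDl.
Qed.

Lemma unit_cube_sub_cball : cube 0 1 `<=` cball (0 : V) n.+1%:R.
Proof.
move=> x xQ; rewrite /cball/= subr0 enorm_leP//.
apply: (@le_trans _ _ (\sum_(i < n.+1) 1)).
  apply: ler_sum => i _; have := xQ i; rewrite !mxE add0r => /andP[x0 x1].
  by rewrite mulr_ile1// ltW.
by rewrite sumr_const card_ord -natrX ler_nat leq_pmulr.
Qed.

Variable u : V.
Hypothesis hu : enorm u = 1.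

(** By translation and homothety, the image of a cube of side l has measure c l^n
    with c the measure of the image of the unit cube, so images of arbitrary sets
    grow by at most the factor c. Let B be the unit ball, which the reflection fixes,
    inside a cube C. The image of C has measure exactly c Hn C, while
    its parts inside and outside B have measures at most Hn B and c Hn (C \ B).
    Hence c Hn B <= Hn B, and c <= 1. *)
Lemma Hn_reflection_le A : (Hn (reflection_set u A) <= Hn A)%E.
Proof.
pose Q : set V := cube 0 1.
have Q_center : nbhs (const_mx 2^-1 : V) Q.
  apply: filterS (cball_nbhs _ (_ : 0 < 4^-1)); last by rewrite invr_gt0.
  move=> y xy i; have := le_trans (coord_le_enorm _ i) xy.
  by rewrite !mxE ler_norml => /andP[h1 h2]; apply/andP; split; lra.
have Qimg_gt0 : (0 < Hn (reflection_set u Q))%E.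
  apply: (@Hn_nbhs_gt0 _ _ (reflection u (const_mx 2^-1))).
  rewrite (reflection_setE hu); apply: (reflection_continuous (x := _)).
  by rewrite (reflectionK hu).
have Qimg_fin : Hn (reflection_set u Q) \is a fin_num.
  rewrite ge0_fin_numE ?Hn_ge0//.
  apply: le_lt_trans (le_Hn (image_subset _ unit_cube_sub_cball)) _.
  by rewrite [X in Hn X](reflection_cball hu) Hn_cball_fin.
pose c := fine (Hn (reflection_set u Q)).
have Qimg : Hn (reflection_set u Q) = c%:E by rewrite fineK.
have c0 : 0 < c by rewrite -lte_fin -Qimg.
have img_cube v l : 0 < l -> Hn (reflection u @` cube v l) = (c * l ^+ n.+1)%:E.
  move=> l0; rewrite mulrC EFinM -Qimg -(Hn_homothety (reflection u v))//.
  congr (Hn _); rewrite cubeE// !image_comp; apply: eq_imagel => x _ /=.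
  by rewrite reflectionD reflectionZ.
have img_le B : (Hn (reflection_set u B) <= c%:E * Hn B)%E.
  by apply: Hn_image_le_of_cubes => // v l l0; rewrite img_cube.
suff c1 : c <= 1.
  apply: le_trans (img_le A) _; rewrite -[leRHS]mul1e.
  by rewrite lee_wpmul2r ?Hn_ge0// lee_fin.
pose B : set V := cball 0 1; pose C : set V := cube (0 - const_mx (2 * 1)) (4 * 1).
have BC : B `<=` C by exact: cball_sub_cube.
have mB : caratheodory_measurable (@Hn R n.+1) B.
  exact: measurable_closed (@cball_closed R n.+1 0 1).
have reflB : reflection_set u B = B.
  by rewrite (reflection_cball hu) reflection0.
have Bfin : Hn B \is a fin_num by rewrite ge0_fin_numE ?Hn_ge0 ?Hn_cball_fin.
have B0 : 0 < fine (Hn B).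
  rewrite -lte_fin fineK//; apply: (@Hn_nbhs_gt0 _ _ 0); exact: cball_nbhs.
have CE : Hn C = (Hn B + Hn (C `&` ~` B))%E.
  by rewrite {1}(mB C); congr (Hn _ + _)%E; apply/setIidr.
have CBfin : Hn (C `&` ~` B) \is a fin_num.
  rewrite ge0_fin_numE ?Hn_ge0//; apply: le_lt_trans (le_Hn (@subIsetl _ C _)) _.
  by rewrite Hn_cube ?ltry.
have CimgE : (c%:E * Hn C <= Hn B + c%:E * Hn (C `&` ~` B))%E.
  rewrite {1}Hn_cube ?mulr_ge0// -EFinM.
  rewrite -(img_cube (0 - const_mx (2 * 1)))// -/C.
  rewrite (mB (reflection u @` _)); apply: leeD; first by apply: le_Hn; exact: subIsetr.
  apply: le_trans (img_le _); apply: le_Hn => x [[y Cy <-]] By.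
  exists y => //; split=> // By'; apply: By.
  by rewrite -reflB; exists y.
move: CimgE; rewrite CE -(fineK Bfin) -(fineK CBfin) -EFinD -!EFinM -EFinD lee_fin.
by rewrite mulrDr lerD2r ger_pMl.
Qed.

Lemma Hn_reflection A : Hn (reflection_set u A) = Hn A.
Proof.
apply/eqP; rewrite eq_le Hn_reflection_le/=.
by rewrite -{1}(reflection_setK hu A) Hn_reflection_le.
Qed.

Lemma measurable_reflection A : caratheodory_measurable (@Hn R n.+1) A ->
  caratheodory_measurable (@Hn R n.+1) (reflection_set u A).
Proof.
move=> mA X; rewrite -Hn_reflection (mA (reflection_set u X)).
by congr (_ + _)%E; rewrite -Hn_reflection; congr (Hn _);
  rewrite !(reflection_setE hu) /preimage; apply/seteqP; split=> x /=;
  rewrite (reflectionK hu).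
Qed.

End reflection_invariance.

(** * Boundaries of convex sets *)

Section convex_sets.
Context {R : realType} {n : nat}.
Local Notation V := 'rV[R]_n.+1.
Implicit Types (x y v p w : V) (K : set V) (s t : R).

Lemma Hn_bounded_sub_cube K : bounded_set K ->
  exists v (l : R), 0 < l /\ K `<=` cube v l.
Proof.
move=> [M [_ KM]]; pose m := `|M| + 1.
have Mm : M < m by apply: le_lt_trans (ler_norm M) _; rewrite ltrDl.
have m0 : 0 < m by apply: ltr_wpDl.
exists (const_mx (- (m + 1))), (2 * (m + 1)); split.
  by rewrite mulr_gt0// addr_gt0.
move=> x Kx i; have := KM _ Mm _ Kx; rewrite /Num.norm/= mx_normrE.
move=> /bigmax_leP[_ /(_ (ord0, i) isT)] /=; rewrite ler_norml => /andP[h1 h2].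
by rewrite !mxE; apply/andP; split; lra.
Qed.

Lemma compact_measurable K : compact K -> caratheodory_measurable (@Hn R n.+1) K.
Proof.
by move=> cK; apply: measurable_closed; apply: compact_closed => //;
  exact: norm_hausdorff.
Qed.

Lemma Hn_compact_fin K : compact K -> Hn K \is a fin_num.
Proof.
move=> /compact_bounded/Hn_bounded_sub_cube[v [l [l0 Kv]]].
rewrite ge0_fin_numE ?Hn_ge0//; apply: le_lt_trans (le_Hn Kv) _.
by rewrite Hn_cube ?ltry// ltW.
Qed.

(** With e a coordinate vector not parallel to the hyperplane, the translates of K by
    e / (k + 1) are pairwise disjoint, have the same measure as K, and all lie in one
    cube. *)
Lemma Hn_flat K w (c : R) : compact K -> w != 0 ->
  K `<=` [set x | dotp x w = c] -> Hn K = 0%E.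
Proof.
move=> cK w0 Kw.
have [i wi] : exists i, w ord0 i != 0.
  apply/existsP; apply: contraNT w0 => /existsPn w0; apply/eqP/rowP => i.
  by rewrite mxE; apply/eqP/negPn.
pose e : V := delta_mx ord0 i.
have ew : dotp e w = w ord0 i.
  rewrite /dotp (bigD1 i)//= mxE !eqxx mul1r big1 ?addr0// => j /negPf ji.
  by rewrite mxE ji andbF mul0r.
pose f (k : nat) x := k.+1%:R^-1 *: e + x.
pose A (k : nat) := f k @` K.
have mA k : caratheodory_measurable (@Hn R n.+1) (A k).
  apply: compact_measurable; apply: continuous_compact => //.
  apply: continuous_subspaceT => x.
  exact: (continuousD (@cst_continuous _ _ _ x) (@cvg_id _ (nbhs x))).
have tA : trivIset setT A.
  apply/trivIsetP => j k _ _ jk; apply/eqP; apply: contraNT jk => /set0P.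
  move=> [_ [[x Kx <-] [y Ky /(congr1 (fun z => dotp z w))]]].
  rewrite !dotpE !ew (Kw _ Kx) (Kw _ Ky) => /addIr/(mulIf wi)/invr_inj/eqP.
  by rewrite eqr_nat eqSS eq_sym.
have [v [l [l0 Kv]]] := Hn_bounded_sub_cube (compact_bounded cK).
have Kfin := Hn_compact_fin cK.
have bound (N : nat) : (N%:R * fine (Hn K) <= (l + 1) ^+ n.+1).
  have : (Hn (cube v (l + 1) `&` \big[setU/set0]_(k < N) A k) <=
      ((l + 1) ^+ n.+1)%:E)%E.
    apply: le_trans (le_Hn (@subIsetl _ _ _)) _.
    by rewrite Hn_cube// addr_ge0// ltW.
  rewrite (caratheodory_additive mA tA) (eq_bigr (fun=> (fine (Hn K))%:E)).
    by rewrite sumEFin lee_fin sumr_const card_ord mulr_natl.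
  move=> k _; rewrite fineK//= -[RHS](Hn_translation (k.+1%:R^-1 *: e)).
  congr (Hn _); apply/setIidr => _ [x Kx <-] j; have := Kv _ Kx j.
  have : 0 <= (k.+1%:R^-1 : R) <= 1 by rewrite invr_ge0 ler0n invf_le1 ?ler1n ?ltr0n.
  rewrite !mxE eqxx /=; set t := _^-1 => /andP[t0 t1] /andP[h1 h2].
  by case: (j == i); rewrite ?mulr1 ?mulr0; apply/andP; split; lra.
apply/eqP; rewrite -(fineK Kfin) eqe eq_le fine_ge0 ?Hn_ge0// andbT leNgt.
apply/negP => K0; have := bound (Num.trunc ((l + 1) ^+ n.+1 / fine (Hn K))).+1.
by rewrite leNgt -ltr_pdivrMr// -truncn_le_nat leqnn.
Qed.

(** A homothety of ratio 1 - s centred at an interior point p carries K into its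
    interior: the image of x is surrounded by the combinations of x with the points
    of a ball around p. *)
Lemma interior_convex K p x s : convex_set K -> interior K p -> K x ->
  0 < s -> s <= 1 -> interior K (s *: p + (1 - s) *: x).
Proof.
move=> /convex_setP cK /nbhs_cball[r r0 rK] Kx s0 s1.
apply: filterS (cball_nbhs _ (mulr_gt0 s0 r0)) => z /= zr.
(* z is the convex combination of x and of a point q near p. *)
pose q := p + s^-1 *: (z - (s *: p + (1 - s) *: x)).
have -> : z = s *: q + (1 - s) *: x.
  by apply/rowP => i; rewrite !mxE; field; rewrite gt_eqF.
apply: cK => //; first exact: ltW.
apply: rK; rewrite /cball/= addrC addKr enormZ gtr0_norm ?invr_gt0//.
by rewrite ler_pdivrMl.
Qed.

Lemma one_minus_expn_ge s (N : nat) : 0 <= s -> s <= 1 -> 1 - N%:R * s <= (1 - s) ^+ N.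
Proof.
move=> s0 s1; elim: N => [|N IH]; first by rewrite mul0r subr0.
rewrite exprS -natr1.
have : (1 - s) * (1 - N%:R * s) <= (1 - s) * (1 - s) ^+ N.
  by rewrite ler_wpM2l// subr_ge0.
apply: le_trans; have : 0 <= N%:R * s ^+ 2 by rewrite mulr_ge0 ?sqr_ge0.
by rewrite expr2; lra.
Qed.

(** By [interior_convex], (1 - s)^d Hn K <= Hn (interior K) in dimension d for all
    small s, so K and its interior have the same measure. *)
Lemma Hn_convex_boundary K p : compact K -> convex_set K -> interior K p ->
  Hn (K `\` interior K) = 0%E.
Proof.
move=> compK convK Kp; have Kfin := Hn_compact_fin compK.
have intK : interior K `<=` K := @interior_subset _ K.
have Ifin : Hn (interior K) \is a fin_num.
  rewrite ge0_fin_numE ?Hn_ge0//; apply: le_lt_trans (le_Hn intK) _.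
  by rewrite -ge0_fin_numE ?Hn_ge0.
pose k := fine (Hn K); pose h := fine (Hn (interior K)).
have k0 : 0 <= k by rewrite fine_ge0 ?Hn_ge0.
have shrink s : 0 < s -> s < 1 -> (1 - n.+1%:R * s) * k <= h.
  move=> s0 s1; apply: (@le_trans _ _ ((1 - s) ^+ n.+1 * k)).
    by rewrite ler_wpM2r// one_minus_expn_ge// ltW.
  rewrite -lee_fin EFinM !fineK// -(Hn_homothety (s *: p)) ?subr_gt0//.
  apply: le_Hn => _ [x Kx <-]; apply: interior_convex => //; exact: ltW.
have kh : k <= h.
  apply/ler_addgt0Pr => e e0; pose d := e + n.+1%:R * (k + 1).
  have nk0 : 0 < n.+1%:R * (k + 1) by rewrite mulr_gt0// ltr_wpDl.
  have d0 : 0 < d by rewrite addr_gt0.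
  have := shrink (e / d); rewrite divr_gt0// ltr_pdivrMr// mul1r ltrDl.
  move=> /(_ isT nk0); suff : n.+1%:R * (e / d) * k <= e by lra.
  have -> : n.+1%:R * (e / d) * k = e * (n.+1%:R * k / d) by ring.
  rewrite ger_pMr// ler_pdivrMr// mul1r /d mulrDr mulr1.
  by have : 0 <= n.+1%:R :> R by []; lra.
have := measurable_open (@open_interior _ K) K.
rewrite (setIidr intK) -(fineK Kfin) => KE.
apply/eqP; rewrite eq_le Hn_ge0 andbT -(@leeD2lE _ (Hn (interior K)))// adde0.
by rewrite -KE -(fineK Ifin) lee_fin.
Qed.

(** Iterating convexity needs a division by the partial sum of the weights; sums are
    therefore written as a nonnegative multiple of a single point of K - x0. *)
Lemma convex_comb K m (c : 'I_m -> R) (y : 'I_m -> V) x0 : convex_set K ->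
  (forall i, 0 <= c i) -> \sum_i c i <= 1 -> K x0 -> (forall i, K (x0 + y i)) ->
  K (x0 + \sum_i c i *: y i).
Proof.
move=> /convex_setP cK.
have comb : (forall i, 0 <= c i) -> K x0 -> (forall i, K (x0 + y i)) ->
    exists2 z, K (x0 + z) & \sum_i c i *: y i = (\sum_i c i) *: z.
  elim: m c y => [|m IH] c y c0 Kx0 Ky.
    by exists 0; rewrite ?addr0// !big_ord0 scale0r.
  have [z Kz zE] := IH (c \o lift ord0) (y \o lift ord0) (fun i => c0 _) Kx0 (fun i => Ky _).
  rewrite !big_ord_recl; set s := \sum_(i < m) c _.
  have -> : \sum_(i < m) c (lift ord0 i) *: y (lift ord0 i) = s *: z by exact: zE.
  have s0 : 0 <= s by apply: sumr_ge0 => i _.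
  have [cs0|cs0] := eqVneq (c ord0 + s) 0.
    have [c00 s00] : c ord0 = 0 /\ s = 0.
      by have := c0 ord0; split; lra.
    by exists z; rewrite // c00 s00 !scale0r addr0 add0r scale0r.
  have cs : 0 < c ord0 + s by rewrite lt_neqAle eq_sym cs0 addr_ge0.
  pose t := c ord0 / (c ord0 + s).
  exists (t *: y ord0 + (1 - t) *: z).
    have -> : x0 + (t *: y ord0 + (1 - t) *: z) =
        t *: (x0 + y ord0) + (1 - t) *: (x0 + z).
      by apply/rowP => i; rewrite !mxE; ring.
    apply: cK => //; first by rewrite divr_ge0// ltW.
    by rewrite ler_pdivrMr// mul1r lerDl.
  by apply/rowP => i; rewrite !mxE /t; field.
move=> c0 s1 Kx0 Ky; have [z Kz ->] := comb c0 Kx0 Ky.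
set s := \sum_i _ in s1 *.
have -> : x0 + s *: z = s *: (x0 + z) + (1 - s) *: x0.
  by apply/rowP => i; rewrite !mxE; ring.
by apply: cK => //; exact: sumr_ge0.
Qed.

(** Take a matrix M of maximal rank whose rows are differences x - x0 with x in K. All
    such differences lie in its row space. If M has full column rank, K contains
    the simplex spanned by x0 and a basis chosen among the rows; otherwise a nonzero column of
    the cokernel of M is a normal vector of a hyperplane containing K. *)
Lemma convex_flat_or_solid K x0 : convex_set K -> K x0 ->
  interior K !=set0 \/
  exists w, w != 0 /\ K `<=` [set x | dotp x w = dotp x0 w].
Proof.
move=> cK Kx0.
pose P r := `[< exists m (M : 'M[R]_(m, n.+1)),
  (forall i, K (x0 + row i M)) /\ \rank M = r >].
have P0 : exists r, P r.
  exists 0%N; apply/asboolP; exists 0%N, 0; split; last by rewrite mxrank0.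
  by case.
have Pub r : P r -> (r <= n.+1)%N.
  by move=> /asboolP[m [M [_ <-]]]; exact: rank_leq_col.
case: (ex_maxnP P0 Pub) => r /asboolP[m [M [KM rkM]]] rmax.
have subM x : K x -> (x - x0 <= M)%MS.
  move=> Kx; apply: contraT => xM.
  have /rmax : P (\rank (col_mx M (x - x0))).
    apply/asboolP; exists (m + 1)%N, (col_mx M (x - x0)); split=> // i.
    have [j ->|j ->] := split_ordP i; first by rewrite rowKu.
    by rewrite rowKd [j]ord1 row_id addrC subrK.
  rewrite leqNgt -{}rkM => /negP[]; apply: rank_ltmx.
  have := submx_refl (col_mx M (x - x0)); rewrite col_mx_sub => /andP[MM xMM].
  by rewrite ltmxE MM col_mx_sub negb_and xM orbT.
have [Mfull|] := boolP (row_full M); last first.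
  rewrite /row_full rkM => rn; right.
  have : cokermx M != 0.
    rewrite -mxrank_eq0 mxrank_coker rkM subn_eq0 -ltnNge.
    by rewrite ltn_neqAle rn -rkM rank_leq_col.
  move=> coker0; have [j wj] : exists j, col j (cokermx M) != 0.
    apply/existsP; apply: contraNT coker0 => /existsPn cj.
    apply/eqP/matrixP => i j; have /negPn/eqP/matrixP/(_ i ord0) := cj j.
    by rewrite !mxE.
  exists (col j (cokermx M))^T; split; first by rewrite -(trmx0 _ _ _) (inj_eq trmx_inj).
  move=> x /subM; rewrite submxE => /eqP/matrixP/(_ ord0 j); rewrite mxE [RHS]mxE.
  move=> xw; apply/eqP; rewrite -subr_eq0 -dotpNl -dotpDl -xw; apply/eqP.
  by apply: eq_bigr => i _; rewrite !mxE.
left; set f := fullrankfun Mfull; pose B := rowsub f M.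
have Bunit : B \in unitmx := fullrowsub_unit Mfull.
pose w (i : 'I_n.+1) : V := (col i (invmx B))^T.
have coordE x i : (x *m invmx B) ord0 i = dotp x (w i).
  by rewrite mxE; apply: eq_bigr => j _; rewrite !mxE.
(* The barycentre of the simplex, at which all barycentric coordinates are
   positive. *)
pose p := x0 + (const_mx n.+2%:R^-1 : V) *m B.
have pw i : dotp (p - x0) (w i) = n.+2%:R^-1.
  by rewrite -coordE /p addrC addKr mulmxK// mxE.
have near_gt0 i : \forall x \near p, 0 < dotp x (w i) - dotp x0 (w i).
  apply: ((continuousB (@dotp_continuous _ _ (w i) p) (@cst_continuous _ _ (dotp x0 (w i)) p))
    [set t | 0 < t]).
  apply: lt_nbhsr; rewrite -[ltRHS]/(dotp p (w i) - dotp x0 (w i)).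
  by rewrite -dotpNl -dotpDl pw invr_gt0.
have near_lt1 : \forall x \near p, dotp x (\sum_i w i) - dotp x0 (\sum_i w i) < 1.
  apply: ((continuousB (@dotp_continuous _ _ (\sum_i w i) p)
    (@cst_continuous _ _ (dotp x0 (\sum_i w i)) p)) [set t | t < 1]).
  apply: lt_nbhsl.
  rewrite -[ltLHS]/(dotp p (\sum_i w i) - dotp x0 (\sum_i w i)) -dotpNl -dotpDl.
  rewrite dotp_sumr (eq_bigr _ (fun i _ => pw i)) sumr_const card_ord.
  by rewrite -[ltLHS]mulr_natl ltr_pdivrMr// mul1r ltr_nat.
exists p; rewrite /interior.
apply: filterS2 (filter_forall _ near_gt0) near_lt1 => x /= xpos xlt1.
have -> : x = x0 + \sum_i (dotp (x - x0) (w i)) *: row (f i) M.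
  rewrite -[LHS](addrNK x0) addrC; congr (_ + _).
  rewrite -[LHS](mulmxKV Bunit) mulmx_sum_row; apply: eq_bigr => i _.
  by rewrite coordE row_rowsub.
apply: convex_comb => //.
- by move=> i; rewrite dotpDl dotpNl ltW.
- by rewrite -dotp_sumr dotpDl dotpNl ltW.
Qed.

End convex_sets.

(** * Essential inclusion and equality *)

Section essential_relations.
Context {R : realType} {n : nat}.
Local Notation V := 'rV[R]_n.+1.
Local Notation measurable := (caratheodory_measurable (@Hn R n.+1)).
Implicit Types A B C K : set V.

Lemma Hn_boundary_null K : compact_convex K -> Hn (K `\` interior K) = 0%E.
Proof.
move=> [[x0 Kx0] compK convK].
have [[p Kp]|[w [w0 Kw]]] := convex_flat_or_solid convK Kx0.
  exact: Hn_convex_boundary Kp.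
by apply: Hn_eq0_sub (Hn_flat compK w0 Kw); exact: subDsetl.
Qed.

Lemma sub_ess_subset A B : A `<=` B -> ess_subset A B.
Proof. by rewrite /ess_subset -setD_eq0 => ->; exact: Hn_set0. Qed.

Lemma ess_subset_trans B A C : ess_subset A B -> ess_subset B C -> ess_subset A C.
Proof.
move=> AB BC; apply: Hn_eq0_sub (Hn_eq0_U AB BC) => x [Ax Cx].
by have [Bx|Bx] := pselect (B x); [right|left].
Qed.

Lemma ess_eqP A B : ess_eq A B <-> ess_subset A B /\ ess_subset B A.
Proof.
split=> [AB|[AB BA]]; last exact: Hn_eq0_U.
by split; apply: Hn_eq0_sub AB; [exact: subsetUl|exact: subsetUr].
Qed.

Lemma ess_eq_sym A B : ess_eq A B -> ess_eq B A.
Proof. by rewrite /ess_eq setUC. Qed.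

Lemma ess_eq_trans B A C : ess_eq A B -> ess_eq B C -> ess_eq A C.
Proof.
move=> /ess_eqP[AB BA] /ess_eqP[BC CB]; apply/ess_eqP.
by split; [exact: ess_subset_trans BC|exact: ess_subset_trans BA].
Qed.

(** The part of A inside B already has the full measure of A, so finiteness and
    additivity leave measure 0 for the rest. *)
Lemma ess_subset_eqHn A B : measurable B -> Hn A \is a fin_num ->
  Hn A = Hn B -> ess_subset B A -> ess_subset A B.
Proof.
move=> mB Afin AB BA; have AE := mB A.
have ABfin : Hn (A `&` B) \is a fin_num.
  rewrite ge0_fin_numE ?Hn_ge0//; apply: le_lt_trans (le_Hn (@subIsetl _ A B)) _.
  by rewrite -ge0_fin_numE ?Hn_ge0.
have BleA : (Hn B <= Hn (A `&` B))%E.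
  rewrite -[leRHS]adde0 -BA; apply: le_trans (HnU _ _); apply: le_Hn => x Bx.
  by have [Ax|Ax] := pselect (A x); [left|right].
apply/eqP; rewrite /ess_subset eq_le Hn_ge0 andbT -(@leeD2lE _ (Hn (A `&` B)))// adde0 -AE.
by rewrite AB.
Qed.

End essential_relations.

(** * Polarization *)

Section polarization_measure.
Context {R : realType} {n : nat}.
Local Notation V := 'rV[R]_n.+1.
Local Notation measurable := (caratheodory_measurable (@Hn R n.+1)).
Variable u : V.
Hypothesis hu : enorm u = 1.
Implicit Types (x y : V) (A B : set V).

Lemma ess_subset_reflection A B : ess_subset A B ->
  ess_subset (reflection_set u A) (reflection_set u B).
Proof.
move=> AB; rewrite /ess_subset -AB -[RHS](Hn_reflection hu); congr (Hn _).
by rewrite !(reflection_setE hu).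
Qed.

Lemma ess_eq_reflection A B : ess_eq A B ->
  ess_eq (reflection_set u A) (reflection_set u B).
Proof.
by move=> /ess_eqP[AB BA]; apply/ess_eqP; split; exact: ess_subset_reflection.
Qed.

Lemma measurable_halfspace_pos : measurable (halfspace_pos u).
Proof.
apply: measurable_closed.
apply: (@preimage_closed _ _ (fun x => dotp x u) [set s | 0 <= s]).
  by move=> x _; exact: dotp_continuous.
exact: closed_ge.
Qed.

(** A form without case distinction: pairs of mirror points in A stay, and a single one
    is moved to the upper half-space. *)
Lemma polarizationE A : polarization u A =
  (A `&` reflection_set u A) `|` ((A `|` reflection_set u A) `&` halfspace_pos u).
Proof.
rewrite (reflection_setE hu); apply/seteqP; split=> x.
  move=> [[Hx [y [[->|->] Ay]]]|[Hx sub]].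
  - by right; split=> //; left.
  - by right; split=> //; right.
  - by left; split; apply: sub; [left|right].
move=> [[Ax Ax']|[[Ax|Ax'] Hx]].
- have [Hx|Hx] := leP 0 (dotp x u).
    by left; split=> //; exists x; split=> //; left.
  by right; split=> [|_ [->|->]]//; exact: ltW.
- by left; split=> //; exists x; split=> //; left.
- by left; split=> //; exists (reflection u x); split=> //; right.
Qed.

Lemma measurable_polarization A : measurable A -> measurable (polarization u A).
Proof.
move=> mA; have mA' := measurable_reflection hu mA; rewrite polarizationE.
apply: caratheodory_measurable_setU; first exact: caratheodory_measurable_setI.
apply: caratheodory_measurable_setI measurable_halfspace_pos.
exact: caratheodory_measurable_setU.
Qed.

(** Outside the symmetric part S, polarization keeps the upper part of A and replaces
    the lower part by its mirror image. *)
Lemma Hn_polarization A : measurable A -> Hn (polarization u A) = Hn A.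
Proof.
move=> mA; have mA' := measurable_reflection hu mA.
pose S := A `&` reflection_set u A; pose L := A `&` ~` S.
have mS : measurable S by exact: caratheodory_measurable_setI.
pose H := halfspace_pos u.
have polS : polarization u A `&` S = S.
  by rewrite polarizationE; apply/setIidr; exact: subsetUl.
have AS : A `&` S = S by rewrite /S setIA setIid.
rewrite (mS (polarization u A)) (mS A) polS AS -/L; congr (_ + _)%E.
rewrite (mA (_ `&` _)) (measurable_halfspace_pos L) -/H.
congr (_ + _)%E; last rewrite -(Hn_reflection hu (L `&` _)); congr (Hn _).
  rewrite polarizationE -/S -/H; apply/seteqP.
  split=> [x [[[//|[_ Hx]] Sx] Ax]|x [[Ax Sx] Hx]]; first by [].
  by split=> //; split=> //; right; split=> //; left.
rewrite polarizationE -/S -/H /L /S !(reflection_setE hu); apply/seteqP; split=> x.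
  move=> [[[//|[[//|Ax'] Hx]] Sx] Ax]; split.
    by split=> // -[_]; rewrite /preimage/= (reflectionK hu).
  rewrite /H/halfspace_pos/= (dotp_reflectionl hu) oppr_ge0 => Hx0; apply: Ax.
  (* A point of the hyperplane is its own mirror image. *)
  have x0 : dotp x u = 0 by apply/eqP; rewrite eq_le Hx0.
  by move: Ax'; rewrite /preimage /= /reflection x0 mulr0 scale0r subr0.
move=> [[Ax' Sx]]; rewrite /setC/= /H/halfspace_pos/= (dotp_reflectionl hu) => Hx.
have Ax : ~ A x.
  by move=> Ax; apply: Sx; split=> //; rewrite /preimage/= (reflectionK hu).
split=> //; split; last by case.
right; split; first by right.
by move/negP: Hx; rewrite oppr_ge0 -ltNge => /ltW.
Qed.

Lemma ess_eq_polarization A B : B `<=` A -> Hn (A `\` B) = 0%E ->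
  ess_eq (polarization u B) (polarization u A).
Proof.
move=> BA AB0; have AB0' := AB0; rewrite -(Hn_reflection hu) in AB0'.
apply: (Hn_eq0_sub _ (Hn_eq0_U AB0 AB0')) => x.
rewrite !polarizationE !(reflection_setE hu) /preimage /=.
have := @BA x; have := @BA (reflection u x).
have [] := pselect (A x); have [] := pselect (B x);
have [] := pselect (A (reflection u x)); have [] := pselect (B (reflection u x));
have [] := pselect (halfspace_pos u x); rewrite /setU /setI /setD /=; tauto.
Qed.

End polarization_measure.

(** * Drums *)

Section drums.
Context {R : realType} {n : nat}.
Local Notation V := 'rV[R]_n.+1.
Variable u : V.
Hypothesis hu : enorm u = 1.
Implicit Types (x y z : V) (K : set V) (r s t : R).

Definition hproj x : V := x - dotp x u *: u.

Lemma hprojK x : hproj x + dotp x u *: u = x.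
Proof. by rewrite subrK. Qed.

Lemma hprojB x y : hproj (x - y) = hproj x - hproj y.
Proof. by apply/rowP => i; rewrite !mxE dotpDl dotpNl; ring. Qed.

Lemma hproj_hyperplane x : hyperplane u (hproj x).
Proof. by rewrite /hyperplane/= !dotpE (dotp_unit hu) mulr1 subrr. Qed.

Lemma hproj_id y : hyperplane u y -> hproj y = y.
Proof. by rewrite /hyperplane/= /hproj => ->; rewrite scale0r subr0. Qed.

Lemma enorm_proj_le x : enorm (hproj x) <= enorm x.
Proof.
rewrite enorm_leP ?enorm_ge0// enorm_sqr /hproj !dotpE (dotpC u x) (dotp_unit hu).
by have := sqr_ge0 (dotp x u); rewrite expr2; lra.
Qed.

Lemma dotp_unit_le x : `|dotp x u| <= enorm x.
Proof.
rewrite ler_norml lerNl -dotpNl; apply/andP; split.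
  by have := dotp_le (- x) u; rewrite enormN hu mulr1.
by have := dotp_le x u; rewrite hu mulr1.
Qed.

Lemma hproj_continuous : continuous hproj.
Proof.
move=> x; apply: (continuousB (@cvg_id _ (nbhs x))).
by apply: (@continuousZ _ _ _ (fun y => dotp y u) (fun=> u));
  [exact: dotp_continuous|exact: cst_continuous].
Qed.

Lemma cylinderP y r x : hyperplane u y -> cylinder u y r x <-> enorm (hproj x - y) <= r.
Proof.
move=> Hy; split=> [[z [zr Hz] [t _ <-]]|xr].
  suff -> : hproj (z + t *: u) = z by [].
  by rewrite /hproj !dotpE (dotp_unit hu) Hz add0r mulr1 addrK.
exists (hproj x); first by split=> //; exact: hproj_hyperplane.
by exists (dotp x u) => //; exact: hprojK.
Qed.

(** A convex body cut out by a ball and a cylinder, the two kinds of sets on which the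
    behaviour of the map is known. *)
Definition drum y r s : set V := cball y r `&` cylinder u y s.

Lemma drumE y r s : hyperplane u y ->
  drum y r s = cball y r `&` (hproj @^-1` cball y s).
Proof.
move=> Hy; apply/seteqP; split=> x [xr xs]; split=> //.
  exact: (cylinderP _ _ Hy).1.
exact: (cylinderP _ _ Hy).2.
Qed.

Lemma drum_convex_body y r s : hyperplane u y -> 0 < r -> 0 < s ->
  convex_bodies (drum y r s).
Proof.
move=> Hy r0 s0.
have drum_y : interior (drum y r s) y.
  rewrite drumE//; apply: filterI; first exact: cball_nbhs.
  by apply: hproj_continuous; rewrite hproj_id//; exact: cball_nbhs.
split; last by exists y.
split; first by exists y; exact: interior_subset drum_y.
  have drum_closed : closed (drum y r s).
    rewrite drumE//; apply: closedI; first exact: cball_closed.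
    by apply: preimage_closed; [move=> x _; exact: hproj_continuous|exact: cball_closed].
  exact: (subclosed_compact drum_closed (@cball_compact _ _ y r) (@subIsetl _ _ _)).
rewrite drumE//; apply/convex_setP => x z t t0 t1 [xr xs] [zr zs]; split.
  by apply: (convex_setP _).1 => //; exact: cball_convex.
rewrite /preimage /=.
have -> : hproj (t *: x + (1 - t) *: z) = t *: hproj x + (1 - t) *: hproj z.
  by apply/rowP => i; rewrite !mxE !dotpE; ring.
by apply: (convex_setP _).1 => //; exact: cball_convex.
Qed.

Lemma clamp (T m e : R) : 0 <= m -> 0 <= e -> `|T| <= m + e ->
  exists T', `|T - T'| <= e /\ `|T'| <= m.
Proof.
move=> m0 e0; rewrite ler_norml => /andP[h1 h2].
have [h3|h3] := lerP T (- m).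
  by exists (- m); rewrite !ler_norml; split; apply/andP; split; lra.
have [h4|h4] := lerP m T.
  by exists m; rewrite !ler_norml; split; apply/andP; split; lra.
by exists T; rewrite !ler_norml; split; apply/andP; split; lra.
Qed.

(** A point z of the drum is within r of a point y + T' u of the segment from x to
    its mirror image, so it lies on the parallel segment that joins the balls around
    the two end points. *)
Lemma drum_sub K x r : convex_set K -> 0 < r ->
  cball x r `<=` K -> cball (reflection u x) r `<=` K ->
  drum (hproj x) (`|dotp x u| + r / 2) (r / 2) `<=` K.
Proof.
move=> /convex_setP cK r0 xK x'K z; rewrite drumE; last exact: hproj_hyperplane.
set t := dotp x u; set y := hproj x; move=> [zr zs].
pose T := dotp z u.
have Tr : `|T| <= `|t| + r / 2.
  have -> : T = dotp (z - y) u by rewrite dotpDl dotpNl (hproj_hyperplane x) oppr0 addr0.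
  exact: le_trans (dotp_unit_le _) _.
have [T' [TT' T't]] := clamp (normr_ge0 t) (ltW (divr_gt0 r0 (ltr0Sn _ 1))) Tr.
(* The weight with which y + T' u divides the segment; for t = 0 the segment is a
   point, and the convention x / 0 = 0 gives weight 1/2. *)
pose l := (1 + T' / t) / 2.
have lt_T' : l * t - (1 - l) * t = T'.
  rewrite /l; have [t0|t0] := eqVneq t 0; last by field.
  by move: T't; rewrite t0 normr0 normr_le0 => /eqP ->; ring.
have l01 : 0 <= l <= 1.
  have : `|T' / t| <= 1.
    have [->|t0] := eqVneq t 0; first by rewrite invr0 mulr0 normr0.
    by rewrite normrM normfV ler_pdivrMr ?normr_gt0// mul1r.
  by rewrite ler_norml /l => /andP[h1 h2]; apply/andP; split; lra.
have /andP[l0 l1] := l01.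
pose v := z - (y + T' *: u).
have vr : enorm v <= r.
  have -> : v = (hproj z - y) + (T - T') *: u.
    by apply/rowP => i; rewrite !mxE /T; ring.
  apply: le_trans (enormD _ _) _; rewrite enormZ hu mulr1.
  by move: TT' zs; rewrite /preimage/cball/=; lra.
have -> : z = l *: (x + v) + (1 - l) *: (reflection u x + v).
  rewrite /v -lt_T'; apply/rowP => i; rewrite !mxE -/t; ring.
by apply: cK => //; [apply: xK|apply: x'K]; rewrite /cball/= addrC addKr.
Qed.

Lemma drum_nbhs x r : 0 < r ->
  nbhs x (drum (hproj x) (`|dotp x u| + r / 2) (r / 2)).
Proof.
move=> r0; have r20 : 0 < r / 2 by rewrite divr_gt0.
apply: filterS (cball_nbhs x r20) => z zr.
rewrite drumE; last exact: hproj_hyperplane; split; last first.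
  rewrite /preimage/cball/= -hprojB; exact: le_trans (enorm_proj_le _) _.
rewrite /cball/=; have -> : z - hproj x = (z - x) + dotp x u *: u.
  by apply/rowP => i; rewrite !mxE; ring.
by apply: le_trans (enormD _ _) _; rewrite enormZ hu mulr1 addrC lerD2l.
Qed.

End drums.

(** * Maps that move balls vertically *)

Section vertical_motion.
Context {R : realType} {n : nat}.
Local Notation V := 'rV[R]_n.+1.
Implicit Types (x y : V) (K : set V) (r s t : R).

Section stretched_map.
Variables (u : V) (E : set (set V)) (D : set V -> set V) (phi : R -> R).
Hypothesis hu : enorm u = 1.
Hypothesis hEsub : E `<=` @compact_convex R n.+1.
Hypothesis hEsup : @convex_bodies R n.+1 `<=` E.
Hypothesis hD : forall K, E K -> finite_measurable (D K).
Hypothesis hmono : monotonic E D.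
Hypothesis hmeas : measure_preserving E D.
Hypothesis hphiD : forall (r : R) (x : V) (t : R), 0 < r -> hyperplane u x ->
  ess_eq (D (cball (x + t *: u) r)) (cball (x + phi t *: u) r).

Lemma image_cball y r : 0 < r ->
  ess_eq (D (cball y r)) (cball (hproj u y + phi (dotp y u) *: u) r).
Proof. by move=> r0; rewrite -{1}(hprojK u y); apply/hphiD/hproj_hyperplane. Qed.

Lemma cball_ess_subset_image K y r : E K -> 0 < r -> cball y r `<=` K ->
  ess_subset (cball (hproj u y + phi (dotp y u) *: u) r) (D K).
Proof.
move=> EK r0 yK; have /ess_eqP[_ sub] := image_cball y r0.
apply: ess_subset_trans sub _; apply: hmono => //; last exact: sub_ess_subset.
by apply: hEsup; exact: cball_convex_body.
Qed.

(** The local inclusions sweep out G inside [D K]; equality of measures does the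
    rest. *)
Lemma image_ess_eq K G : E K -> caratheodory_measurable (@Hn R n.+1) G ->
  Hn G = Hn K ->
  (forall x, G x -> exists2 U, nbhs x U & ess_subset U (D K)) ->
  ess_eq (D K) G.
Proof.
move=> EK mG GK loc; have [_ DKfin] := hD EK.
have GD : ess_subset G (D K).
  apply: Hn_locally_null => x [Gx _]; have [U xU UD] := loc x Gx.
  by exists U => //; apply: Hn_eq0_sub UD => y [Uy [_ Dy]].
apply/ess_eqP; split=> //; apply: ess_subset_eqHn => //.
  by rewrite ge0_fin_numE ?Hn_ge0.
by rewrite hmeas.
Qed.

Lemma Hn_interior K : E K -> Hn (interior K) = Hn K.
Proof.
move=> /hEsub/Hn_boundary_null K0.
apply/eqP; rewrite eq_le le_Hn/=; last exact: interior_subset.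
rewrite -[leRHS]adde0 -K0; apply: le_trans (HnU _ _); apply: le_Hn => x Kx.
by have [|] := pselect (interior K x); [left|right].
Qed.

Lemma interior_ess_eq K : E K -> ess_eq (interior K) K.
Proof.
move=> /hEsub/Hn_boundary_null K0; apply/ess_eqP; split=> //.
by apply: sub_ess_subset; exact: interior_subset.
Qed.

Lemma map_ess_eq_id : (forall t, phi t = t) -> ess_eq_map E D id.
Proof.
move=> phiE K EK; apply: ess_eq_trans (interior_ess_eq EK).
apply: image_ess_eq => //; first exact: measurable_open (@open_interior _ K).
  exact: Hn_interior.
move=> x /nbhs_cball[r r0 rK]; exists (cball x r); first exact: cball_nbhs.
by have := cball_ess_subset_image EK r0 rK; rewrite phiE hprojK.
Qed.

Hypothesis hcyl : respects_cylinders E D u.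

(** The image of the drum stays in the ball, which is fixed since its centre is on the
    hyperplane, and in the cylinder: hence in the drum, whose measure it has. *)
Lemma drum_ess_subset_image y r s : phi 0 = 0 -> hyperplane u y ->
  0 < r -> 0 < s -> ess_subset (drum u y r s) (D (drum u y r s)).
Proof.
move=> phi0 Hy r0 s0; set M := drum u y r s.
have bM : convex_bodies M by exact: drum_convex_body.
have EM := hEsup bM; have [[_ cM _] _] := bM.
have DM_M : ess_subset (D M) M.
  have DMy : ess_subset (D M) (cball y r).
    have /ess_eqP[sub _] := hphiD 0 r0 Hy.
    rewrite phi0 scale0r addr0 in sub; apply: ess_subset_trans sub.
    apply: hmono => //; first by apply: hEsup; exact: cball_convex_body.
    by apply: sub_ess_subset; exact: subIsetl.
  have DMc : ess_subset (D M) (cylinder u y s).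
    by apply: hcyl => //; apply: sub_ess_subset; exact: subIsetr.
  apply: Hn_eq0_sub (Hn_eq0_U DMy DMc) => x [Dx Mx].
  have [yx|yx] := pselect (cball y r x); last by left.
  by right; split=> // cx; apply: Mx.
have [mDM _] := hD EM.
by apply: ess_subset_eqHn => //; [exact: Hn_compact_fin|rewrite hmeas].
Qed.

(** A point of the polarization of the interior of K is either the upper one of a
    mirror pair meeting the interior, and is reached by the image of a ball, or a lower one
    with both points of the pair in the interior, and is reached by a drum. *)
Lemma map_ess_eq_polarization : (forall t, phi t = `|t|) ->
  ess_eq_map E D (polarization u).
Proof.
move=> phiE K EK; have [_ cK convK] := hEsub EK.
have mI : caratheodory_measurable (@Hn R n.+1) (interior K).
  exact: measurable_open (@open_interior _ K).
apply: (@ess_eq_trans _ _ (polarization u (interior K))); last first.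
  apply: ess_eq_polarization => //; first exact: interior_subset.
  exact: Hn_boundary_null (hEsub EK).
apply: image_ess_eq => //; first exact: measurable_polarization.
  by rewrite Hn_polarization//; exact: Hn_interior.
move=> x [[Hx [y [yx /nbhs_cball[r r0 rK]]]]|[_ sub]].
  exists (cball x r); first exact: cball_nbhs.
  have := cball_ess_subset_image EK r0 rK; rewrite phiE.
  suff -> : hproj u y + `|dotp y u| *: u = x by [].
  case: yx => ->; first by rewrite ger0_norm// hprojK.
  rewrite (dotp_reflectionl hu) normrN ger0_norm// /hproj.
  rewrite (dotp_reflectionl hu) /reflection; apply/rowP => i; rewrite !mxE.
  ring.
have [r r0 rK] := nbhs_cball (sub x (or_introl erefl)).
have [r' r'0 r'K] := nbhs_cball (sub (reflection u x) (or_intror erefl)).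
pose e := Num.min r r'.
have e0 : 0 < e by rewrite lt_min r0.
have eK : cball x e `<=` K.
  by move=> z /= /le_trans ze; apply/rK/ze; rewrite ge_min lexx.
have e'K : cball (reflection u x) e `<=` K.
  by move=> z /= /le_trans ze; apply/r'K/ze; rewrite ge_min lexx orbT.
exists (drum u (hproj u x) (`|dotp x u| + e / 2) (e / 2)); first exact: drum_nbhs.
have e20 : 0 < e / 2 by rewrite divr_gt0.
have s0 : 0 < `|dotp x u| + e / 2 by apply: ltr_wpDl.
have Hx := hproj_hyperplane hu x.
apply: ess_subset_trans (drum_ess_subset_image _ Hx s0 e20) _.
  by rewrite phiE normr0.
apply: hmono => //; first by apply: hEsup; exact: drum_convex_body.
by apply: sub_ess_subset; exact: drum_sub.
Qed.

End stretched_map.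
End vertical_motion.

(** * Images of balls determine the height function *)

Section recovering_phi.
Context {R : realType} {n : nat}.
Local Notation V := 'rV[R]_n.+1.
Variable u : V.
Hypothesis hu : enorm u = 1.

(** If t > s, the first ball exceeds the second near its top point (t + 1) u. *)
Lemma cball_ess_subset_le (s t : R) :
  ess_subset (cball (t *: u) 1) (cball (s *: u) 1) -> t <= s.
Proof.
move=> sub; rewrite leNgt; apply/negP => st.
pose e := Num.min (t - s) 1 / 2.
have [e0 et e1] : [/\ 0 < e, e < t - s & e < 1].
  have ts : 0 < t - s by rewrite subr_gt0.
  have m0 : 0 < Num.min (t - s) 1 by rewrite lt_min ts ltr01.
  have : Num.min (t - s) 1 <= t - s by rewrite ge_min lexx.
  have : Num.min (t - s) 1 <= 1 by rewrite ge_min lexx orbT.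
  by rewrite /e; split; lra.
pose p := (t + 1 - e) *: u.
have pE a : enorm (p - a *: u) = `|t + 1 - e - a|.
  by rewrite -scalerBl enormZ hu mulr1.
suff : (0 < Hn (cball (t *: u) 1 `\` cball (s *: u) 1))%E by rewrite sub ltxx.
apply: (@Hn_nbhs_gt0 _ _ p); apply: filterI.
  apply: (@enormB_continuous _ _ _ p [set a | a <= 1]); apply: lt_le_nbhsl.
  by rewrite pE ger0_norm; lra.
apply: (@enormB_continuous _ _ _ p [set a | ~ (a <= 1)]).
apply: (@filterS _ _ _ [set a | 1 < a]) => [a /=|]; first by rewrite leNgt => ->.
by apply: lt_nbhsr; rewrite pE ger0_norm; lra.
Qed.

Lemma cball_ess_eq_inj (s t : R) :
  ess_eq (cball (t *: u) 1) (cball (s *: u) 1) -> t = s.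
Proof.
move=> /ess_eqP[ts st]; apply/eqP.
by rewrite eq_le !cball_ess_subset_le.
Qed.

Lemma polarization_cball (t : R) :
  polarization u (cball (t *: u) 1) = cball (`|t| *: u) 1.
Proof.
have ballE a x : cball (a *: u) 1 x <->
    dotp x x + a ^+ 2 - 1 <= 2 * (a * dotp x u).
  rewrite /cball/= enorm_leP// expr1n !dotpE (dotpC u x) (dotp_unit hu).
  by split; lra.
have reflE x : cball (t *: u) 1 (reflection u x) <->
    dotp x x + t ^+ 2 - 1 <= - (2 * (t * dotp x u)).
  rewrite ballE -enorm_sqr enorm_reflection// enorm_sqr dotp_reflectionl//.
  by rewrite !mulrN.
have absE x : cball (`|t| *: u) 1 x <->
    dotp x x + t ^+ 2 - 1 <= 2 * (`|t| * dotp x u).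
  by rewrite ballE real_normK ?num_real.
rewrite polarizationE// reflection_setE//; apply/seteqP; split=> x.
  move=> xP; apply/absE; move: xP.
  have [t0|t0] := ler0P t => -[[/ballE h1 /reflE h2]|[[/ballE h|/reflE h] /= d0]];
    try (by lra).
    by have := mulr_le0_ge0 t0 d0; lra.
  by have := mulr_ge0 (ltW t0) d0; lra.
move=> /absE; have [d0|d0] := lerP 0 (dotp x u); have [t0|t0] := ler0P t => xt.
- by right; split=> //; right; apply/reflE; lra.
- by right; split=> //; left; apply/ballE; lra.
- have td := mulr_le0 t0 (ltW d0).
  by left; split; [apply/ballE|apply/reflE]; lra.
- have td := mulr_ge0_le0 (ltW t0) (ltW d0).
  by left; split; [apply/ballE|apply/reflE]; lra.
Qed.

End recovering_phi.

(** * Composing with the reflection *)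

Section reflected_map.
Context {R : realType} {n : nat}.
Local Notation V := 'rV[R]_n.+1.
Variables (u : V) (E : set (set V)) (D : set V -> set V) (phi : R -> R).
Hypothesis hu : enorm u = 1.

Lemma reflection_hyperplane (x : V) : hyperplane u x -> reflection u x = x.
Proof. by rewrite /hyperplane/reflection/= => ->; rewrite mulr0 scale0r subr0. Qed.

Lemma reflection_unit : reflection u u = - u.
Proof. by apply/rowP => i; rewrite !mxE (dotp_unit hu); ring. Qed.

(** The axis of the cylinder is orthogonal to the mirror. *)
Lemma reflection_cylinder (x : V) (r : R) :
  reflection_set u (cylinder u x r) `<=` cylinder u x r.
Proof.
move=> _ [_ [y [yr Hy] [t _ <-]] <-]; exists y => //; exists (- t) => //.
by rewrite reflectionD reflectionZ reflection_unit reflection_hyperplane// scaleNr scalerN.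
Qed.

Let D' K := reflection_set u (D K).

Lemma reflected_finite_measurable : (forall K, E K -> finite_measurable (D K)) ->
  forall K, E K -> finite_measurable (D' K).
Proof.
move=> hD K /hD[mDK finDK]; split; first exact: measurable_reflection.
by rewrite Hn_reflection.
Qed.

Lemma reflected_monotonic : monotonic E D -> monotonic E D'.
Proof.
by move=> hmono K L EK EL /(hmono _ _ EK EL); exact: ess_subset_reflection.
Qed.

Lemma reflected_measure_preserving :
  measure_preserving E D -> measure_preserving E D'.
Proof. by move=> hmeas K EK; rewrite Hn_reflection// hmeas. Qed.

Lemma reflected_respects_cylinders :
  respects_cylinders E D u -> respects_cylinders E D' u.
Proof.
move=> hcyl K x r EK r0 /(hcyl _ _ _ EK r0)/(ess_subset_reflection hu) sub.
by apply: ess_subset_trans sub _; apply: sub_ess_subset; exact: reflection_cylinder.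
Qed.

Lemma reflected_phi :
  (forall r x t, 0 < r -> hyperplane u x ->
     ess_eq (D (cball (x + t *: u) r)) (cball (x + phi t *: u) r)) ->
  forall r x t, 0 < r -> hyperplane u x ->
     ess_eq (D' (cball (x + t *: u) r)) (cball (x + - phi t *: u) r).
Proof.
move=> hphiD r x t r0 Hx; have := ess_eq_reflection hu (hphiD r x t r0 Hx).
rewrite (reflection_cball hu) reflectionD reflectionZ reflection_unit.
by rewrite reflection_hyperplane// scaleNr scalerN.
Qed.

Lemma ess_eq_map_reflected (F : set V -> set V) :
  ess_eq_map E D' F -> ess_eq_map E D (fun K => reflection_set u (F K)).
Proof.
move=> DF K EK; have := ess_eq_reflection hu (DF K EK).
by rewrite (reflection_setK hu).
Qed.

End reflected_map.

(** * The four maps *)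

Theorem corollary6p7 (R : realType) (n : nat) (hn : (2 <= n)%N)
    (u : 'rV[R]_n) (hu : enorm u = 1)
    (E : set (set 'rV[R]_n))
    (hE : E = @convex_bodies R n \/ E = @compact_convex R n)
    (D : set 'rV[R]_n -> set 'rV[R]_n)
    (hD : forall K, E K -> finite_measurable (D K))
    (hmono : monotonic E D)
    (hmeas : measure_preserving E D)
    (hcyl : respects_cylinders E D u)
    (hball : maps_balls_to_balls E D)
    (phi : R -> R)
    (hphi : 1.-lipschitz phi)
    (hphiD : forall (r : R) (x : 'rV[R]_n) (t : R),
       0 < r -> hyperplane u x ->
       ess_eq (D (cball (x + t *: u) r)) (cball (x + phi t *: u) r)) :
  [/\ (forall t, phi t = t) <-> ess_eq_map E D id,
      (forall t, phi t = - t) <-> ess_eq_map E D (reflection_set u),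
      (forall t, phi t = `|t|) <-> ess_eq_map E D (polarization u)
    & (forall t, phi t = - `|t|) <->
        ess_eq_map E D (fun A => reflection_set u (polarization u A))].
Proof.
case: n => [//|n] in hn u hu E hE D hD hmono hmeas hcyl hball hphiD *.
have Esub : E `<=` @compact_convex R n.+1 by case: hE => -> // K [].
have Esup : @convex_bodies R n.+1 `<=` E by case: hE => -> // K [].
(* The image of the unit ball centred at t u determines phi t. *)
have phi_of (F : set 'rV[R]_n.+1 -> set 'rV[R]_n.+1) (f : R -> R) :
    (forall t, F (cball (t *: u) 1) = cball (f t *: u) 1) ->
    ess_eq_map E D F -> forall t, phi t = f t.
  move=> Fball DF t; apply: (cball_ess_eq_inj hu).
  have H0 : hyperplane u 0 by rewrite /hyperplane/= -(scale0r u) dotpZl mul0r.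
  have := hphiD 1 0 t ltr01 H0; rewrite !add0r => /ess_eq_sym/ess_eq_trans; apply.
  by rewrite -Fball; apply: DF; apply: Esup; exact: cball_convex_body.
have reflect_ball (t : R) : reflection_set u (cball (t *: u) 1) = cball (- t *: u) 1.
  by rewrite reflection_cball// reflectionZ reflection_unit// scalerN scaleNr.
have hD' := reflected_finite_measurable hu hD.
have hmono' := reflected_monotonic hu hmono.
have hmeas' := reflected_measure_preserving hu hmeas.
have hcyl' := reflected_respects_cylinders hu hcyl.
have hphiD' := reflected_phi hu hphiD.
split; split.
- exact: (map_ess_eq_id hu Esub Esup hD hmono hmeas hphiD).
- exact: phi_of.
- move=> phiN; apply: (@ess_eq_map_reflected _ _ _ _ _ hu id).
  apply: (map_ess_eq_id hu Esub Esup hD' hmono' hmeas' hphiD') => t.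
  by rewrite phiN opprK.
- exact: phi_of.
- exact: (map_ess_eq_polarization hu Esub Esup hD hmono hmeas hphiD hcyl).
- by apply: phi_of => t; exact: polarization_cball.
- move=> phiN; apply: (ess_eq_map_reflected hu).
  apply: (map_ess_eq_polarization hu Esub Esup hD' hmono' hmeas' hphiD' hcyl') => t.
  by rewrite phiN opprK.
- by apply: phi_of => t; rewrite polarization_cball.
Qed.
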